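(* Let $d\ge2$ be a constant and $\phi\ge1$. Starting with an arbitrary tour, the expected number of steps performed by 2-Opt on $\phi$-perturbed Euclidean instances with $n$ vertices is $O(n^7\cdot\log^2(n)\cdot\phi^3)$.
   Context: A $\phi$-perturbed Euclidean instance: vertices $v_1,\ldots,v_n$ are placed independently in $[0,1]^d$, vertex $v_i$ according to a density $f_i\colon[0,1]^d\to[0,\phi]$, with $L_2$ distances. 2-Opt repeatedly performs improving 2-changes (replace tour edges $\{u_1,u_2\},\{v_1,v_2\}$, with $u_1,u_2,v_1,v_2$ distinct and in this order along the tour, by $\{u_1,v_1\},\{u_2,v_2\}$, provided the tour length strictly decreases) until none exists; the bound holds for any initial tour and any choice of improving steps. $O$-notation hides constants depending on $d$. *)

(* Defs.v *)
From HB Require Import structures.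
From mathcomp Require Import all_boot all_order all_algebra.
From mathcomp Require Import all_classical all_reals all_analysis.

Set Implicit Arguments.
Unset Strict Implicit.
Unset Printing Implicit Defensive.

Import Order.TTheory GRing.Theory Num.Theory.
Import numFieldNormedType.Exports.

Local Open Scope classical_set_scope.
Local Open Scope ring_scope.

(* The product sigma-algebra on tuples over [measurableTypeR R] is the Borel
   sigma-algebra of R^d. *)
Notation Rpoint R d := (d.-tuple (measurableTypeR R)).

Section lebesgue_tuple.
Context {R : realType}.

Definition pcons d (z : measurableTypeR R * Rpoint R d) : Rpoint R d.+1 :=
  [tuple of z.1 :: z.2].

Lemma measurable_pcons d : measurable_fun [set: _] (@pcons d).
Proof. exact: measurable_cons. Qed.

Section lebesgue_cons.
Variables (d : nat) (mu : {sigma_finite_measure set (Rpoint R d) -> \bar R}).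

Definition lebesgue_cons : set (Rpoint R d.+1) -> \bar R :=
  pushforward (@lebesgue_measure R \x mu)%E (@pcons d).

Let lebesgue_cons0 : lebesgue_cons set0 = 0%E.
Proof. by rewrite /lebesgue_cons /pushforward preimage_set0 measure0. Qed.

Let lebesgue_cons_ge0 A : (0 <= lebesgue_cons A)%E.
Proof. exact: (measure_ge0 (@lebesgue_measure R \x mu)%E). Qed.

Let lebesgue_cons_sigma_additive : semi_sigma_additive lebesgue_cons.
Proof.
exact: (@measure_semi_sigma_additive _ _ _
  (measure_function_pushforward__canonical__measure_function_Measure
     (@lebesgue_measure R \x mu)%E (@measurable_pcons d))).
Qed.

HB.instance Definition _ := isMeasure.Build _ _ _ lebesgue_cons
  lebesgue_cons0 lebesgue_cons_ge0 lebesgue_cons_sigma_additive.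

Let lebesgue_cons_sigma_finite : sigma_finite [set: Rpoint R d.+1] lebesgue_cons.
Proof.
have /sigma_finiteP[F [TF ndF Foo]] := sigma_finiteT (@lebesgue_measure R).
have /sigma_finiteP[G [TG ndG Goo]] := sigma_finiteT mu.
pose uncons (t : Rpoint R d.+1) : measurableTypeR R * Rpoint R d :=
  (tnth t ord0, [tuple of behead t]).
have unconsK : cancel (@pcons d) uncons.
  by move=> [x t]; congr pair; apply/val_inj.
have muncons : measurable_fun [set: _] uncons.
  apply: measurable_fun_pair; first exact: measurable_tnth.
  exact: measurable_behead.
exists (fun k => uncons @^-1` (F k `*` G k)).
  rewrite -preimage_bigcup; apply/esym/seteqP; split => // t _.
  have [i _ Fi] : (\bigcup_i F i) (uncons t).1 by rewrite -TF.
  have [j _ Gj] : (\bigcup_i G i) (uncons t).2 by rewrite -TG.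
  exists (maxn i j) => //; split.
  - by move: Fi; exact/subsetPset/ndF/leq_maxl.
  - by move: Gj; exact/subsetPset/ndG/leq_maxr.
move=> k; have [mFk Fkoo] := Foo k; have [mGk Gkoo] := Goo k; split.
  by rewrite -[X in measurable X]setTI; apply: muncons => //; exact: measurableX.
rewrite /lebesgue_cons /pushforward -comp_preimage.
rewrite (_ : uncons \o _ = id) ?preimage_id; last exact/funext.
by rewrite product_measure1E// lte_mul_pinfty// ge0_fin_numE.
Qed.

HB.instance Definition _ := Measure_isSigmaFinite.Build _ _ _ lebesgue_cons
  lebesgue_cons_sigma_finite.

End lebesgue_cons.

(* d-dimensional Lebesgue measure on the Borel sets of R^d, as the iterated
   product of the one-dimensional one; R^0 carries the unit mass. *)
Fixpoint lebesgue_tuple d : {sigma_finite_measure set (Rpoint R d) -> \bar R} :=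
  if d is d'.+1 then lebesgue_cons (lebesgue_tuple d') else \d_[tuple].

End lebesgue_tuple.

Section two_opt.
Context {R : realType} {n d : nat}.

Definition dist2 (p q : Rpoint R d) : R :=
  Num.sqrt (\sum_(j < d) ((tnth p j : R) - tnth q j) ^+ 2).

(* A tour lists the n vertices in visiting order; it is read cyclically, so
   [next t u] is the vertex visited after u. *)
Record tour : Type := Tour {
  tour_tuple :> n.-tuple 'I_n;
  tour_uniq : uniq tour_tuple }.

Definition tour_edges (t : tour) : {set {set 'I_n}} :=
  [set [set u; next t u] | u : 'I_n]%SET.

Definition tour_length (x : 'I_n -> Rpoint R d) (t : tour) : R :=
  \sum_(u < n) dist2 (x u) (x (next t u)).

(* For distinct vertices with [next t u1 = u2] and [next t v1 = v2], the order
   along t is u1, u2, v1, v2.  As t' is constrained only through its set of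
   edges, nothing depends on the starting point or the orientation of its
   visiting order. *)
Definition two_change (t t' : tour) : bool :=
  [exists u1, exists u2, exists v1, exists v2,
    [&& uniq [:: u1; u2; v1; v2], next t u1 == u2, next t v1 == v2 &
        tour_edges t' ==
          tour_edges t :\: [set [set u1; u2]; [set v1; v2]]
            :|: [set [set u1; v1]; [set u2; v2]]]]%SET.

Definition improving (x : 'I_n -> Rpoint R d) : rel tour :=
  fun t t' => two_change t t' && (tour_length x t' < tour_length x t).

Definition locally_optimal (x : 'I_n -> Rpoint R d) (t : tour) : Prop :=
  forall t', ~~ improving x t t'.

(* r lists the tours visited after t, so the run performs [size r] steps. *)
Definition two_opt_run (x : 'I_n -> Rpoint R d) (t : tour) (r : seq tour) : Prop :=
  path (improving x) t r /\ locally_optimal x (last t r).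

(* Worst case over the initial tour and over all choices of improving steps. *)
Definition two_opt_steps (x : 'I_n -> Rpoint R d) : \bar R :=
  ereal_sup [set s | exists t r, two_opt_run x t r /\ s = (size r)%:R%:E].

End two_opt.

Section perturbed.
Context {R : realType} {n d : nat} {disp : measure_display}
  {Omega : measurableType disp} (P : probability Omega R).

Definition unit_cube : set (Rpoint R d) :=
  [set p | forall j, 0 <= (tnth p j : R) <= 1].

Definition mutually_independent (X : 'I_n -> {RV P >-> Rpoint R d}) : Prop :=
  forall (J : {set 'I_n}) (A : 'I_n -> set (Rpoint R d)),
    (forall i, measurable (A i)) ->
    P (\bigcap_(i in [set` J]) (X i @^-1` A i)) =
    (\prod_(i in J) P (X i @^-1` A i))%E.

Definition has_density (X : {RV P >-> Rpoint R d}) (f : Rpoint R d -> R) : Prop :=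
  forall A, measurable A ->
    distribution P X A =
    (\int[lebesgue_tuple d]_(p in A `&` unit_cube) (f p)%:E)%E.

(* The values of f i outside the unit cube are irrelevant. *)
Definition perturbed_instance (phi : R) (f : 'I_n -> Rpoint R d -> R)
    (X : 'I_n -> {RV P >-> Rpoint R d}) : Prop :=
  [/\ forall i, measurable_fun unit_cube (f i : _ -> measurableTypeR R),
      forall i p, unit_cube p -> 0 <= f i p <= phi,
      forall i, has_density (X i) (f i) &
      mutually_independent X].

End perturbed.

(* Main.v *)
(* A 2-change on u1, u2, v1, v2 gains F(u1) - F(v2), where
   F(x) = |x - u2| - |x - v1|.  For fixed u2 and v1 at distance about rho, move x
   along a line orthogonal to u2 - v1: there |x - u2|^2 - |x - v1|^2 is constant
   and F is monotone on either side of the foot of u2, with slope controlled by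
   an explicit weight V(x).  Level sets of F of width eps meet {V >= m} in measure
   O(eps / (rho m)), and {V <= v} has measure O(v).  Comparing V(u1) with V(v2)
   bounds the probability of a gain in (0, eps] by O(phi^2 eps log(1/eps) / rho);
   averaging over u2 removes 1 / rho and costs one more factor phi.  A run with k
   steps starts at length at most L = n sqrt(d), so for every t <= k some 2-change
   gains at most L / t.  Summing over the n^4 quadruples and over
   t <= n^n, which bounds the number of steps, gives
   n^5 phi^3 log(n^n)^2. *)

Require Import Defs.
From HB Require Import structures.
From mathcomp Require Import all_boot all_order all_algebra.
From mathcomp Require Import all_classical all_reals all_analysis.
From mathcomp Require Import measurable_realfun ring lra.

Set Implicit Arguments.
Unset Strict Implicit.
Unset Printing Implicit Defensive.

Import Order.TTheory GRing.Theory Num.Theory.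
Import numFieldNormedType.Exports.

Local Open Scope classical_set_scope.
Local Open Scope ring_scope.

(** * Lebesgue measure in the plane *)

(** No uniform bound on the level sets of F is available, because its slope along the line vanishes
    in two situations: at the foot of u2, and on the whole line when it is equidistant from u2 and
    v1. The weight V measures both at once. Comparing V(u1) with V(v2) decides which point is held
    fixed: if it is the one of smaller weight, the other runs through a level window of F on which V
    is at least that weight, so the section has measure at most min(1, K / V) with K of order eps /
    rho. As sublevel sets of V have linearly bounded measure, this minimum integrates to K times a
    logarithm.

    All of this happens in the plane of the last two coordinates. The others only add constants to
    the squared distances, so the dimension enters through the diameter sqrt(d) alone. The
    thresholds L / t with t <= n^n are at least 1 / n^n, which makes both logarithms the same
    harmonic sum. The densities of u1, v2 and u2 cost one factor phi each; the law of v1 is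
    integrated as a probability. *)

Section integral_monotonicity.
Local Open Scope ereal_scope.
Context {disp : measure_display} {T : measurableType disp} {R : realType}.
Implicit Types (mu : {measure set T -> \bar R}) (f g : T -> \bar R).

Import HBNNSimple.

(* Integrals of nonnegative functions are suprema over simple functions, hence
   monotone even for nonmeasurable integrands. *)
Lemma nonneg_le_integral mu f g : (forall x, 0 <= f x) ->
  (forall x, f x <= g x) -> \int[mu]_x f x <= \int[mu]_x g x.
Proof.
move=> f0 fg; have g0 x : 0 <= g x by exact: le_trans (fg x).
rewrite !ge0_integralTE//; apply: ge_ereal_sup => _ [h /= hf <-].
by apply: ereal_sup_ubound; exists h => // x; exact: le_trans (fg x).
Qed.

Lemma nonneg_le_measure_integral (m1 m2 : {measure set T -> \bar R}) f :
  (forall A, measurable A -> m1 A <= m2 A) -> (forall x, 0 <= f x) ->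
  \int[m1]_x f x <= \int[m2]_x f x.
Proof.
move=> m12 f0; rewrite !ge0_integralTE//; apply: ge_ereal_sup => _ [h /= hf <-].
apply: (@le_trans _ _ (sintegral m2 h)); first exact: le_measure_sintegral.
by apply: ereal_sup_ubound; exists h.
Qed.

Lemma nonneg_integral_le_mul mu f (M : \bar R) (D : set T) : measurable D ->
  0 <= M -> (forall x, 0 <= f x) -> (forall x, D x -> f x <= M) ->
  (forall x, ~ D x -> f x = 0) -> \int[mu]_x f x <= M * mu D.
Proof.
move=> mD M0 f0 fM fD.
rewrite -(setIT D) -integral_indic// -ge0_integralZl//; last first.
  exact/measurable_EFinP/measurable_indic.
apply: nonneg_le_integral => // x; rewrite indicE.
have [/set_mem Dx|Dx] := boolP (x \in D); first by rewrite mule1 fM.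
by rewrite fD ?mule0// => Dx'; move/negP: Dx; apply; exact/mem_set.
Qed.

Lemma integral_probability_le (P : probability T R) f (M : \bar R) :
  0 <= M -> (forall x, 0 <= f x) -> (forall x, f x <= M) -> \int[P]_x f x <= M.
Proof.
move=> M0 f0 fM; rewrite -[leRHS]mule1 -[X in _ * X](@probability_setT _ _ _ P).
by apply: nonneg_integral_le_mul => // x nTx; case: (nTx I).
Qed.

End integral_monotonicity.

Section plane.
Context {R : realType}.
Local Notation mR := (measurableTypeR R).
Local Notation leb := (@lebesgue_measure R).

(** Lebesgue measure is determined by its values on half-open intervals, so its pushforward under a
    translation need only be compared there. *)
Lemma lebesgue_measure_translation (c : R) (A : set mR) : measurable A ->
  leb [set x | A (x - c)] = leb A.
Proof.
move=> mA.
have mf : measurable_fun [set: mR] (fun x : mR => x - c : mR).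
  by apply: measurable_funB => //; exact: measurable_id.
apply/esym; have := @lebesgue_measure_unique R
  (measure_function_pushforward__canonical__measure_function_Measure leb mf).
apply => // _ [[a b]] _ <-.
rewrite /= /pushforward.
have -> : (fun x : mR => x - c) @^-1` `]a, b] = `]a + c, b + c]%classic.
  by apply/seteqP; split => x /=; rewrite !in_itv/= ltrBrDr lerBlDr.
rewrite !lebesgue_measure_itv/= !lte_fin ltrD2r.
by case: ifP => // _; rewrite -!EFinB; congr EFin; ring.
Qed.

(** Any point of [E] serves as the centre of an enclosing interval, which costs the factor 2. *)
Lemma lebesgue_small_diameter (E : set mR) (delta : R) : measurable E ->
  0 <= delta -> (forall s s', E s -> E s' -> `|s - s'| <= delta) ->
  (leb E <= (2 * delta)%:E)%E.
Proof.
move=> mE d0 dE; have [->|/set0P[s0 Es0]] := eqVneq E set0.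
  by rewrite measure0 lee_fin; lra.
apply: (@le_trans _ _ (leb `[s0 - delta, s0 + delta]%classic)).
  apply: le_measure; rewrite ?inE//.
  move=> s Es /=; rewrite in_itv/=; have := dE _ _ Es Es0.
  by rewrite ler_distl => /andP[? ?]; apply/andP; split; lra.
rewrite lebesgue_measure_itv/= lte_fin.
by case: ifP => _; rewrite -?EFinB lee_fin; lra.
Qed.

(** Only points on the same side of [sigma] are compared: a level set of F may have one cluster on
    each side of the foot, arbitrarily far apart. *)
Lemma lebesgue_small_diameter_sides (E : set mR) (sigma delta : R) :
  measurable E -> 0 <= delta ->
  (forall s s', E s -> E s' -> sigma <= s -> s <= s' -> s' - s <= delta) ->
  (forall s s', E s -> E s' -> s' <= s -> s <= sigma -> s - s' <= delta) ->
  (leb E <= (4 * delta)%:E)%E.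
Proof.
move=> mE d0 dEr dEl.
have mEr : measurable (E `&` `[sigma, +oo[) by exact: measurableI.
have mEl : measurable (E `&` `]-oo, sigma]) by exact: measurableI.
rewrite (_ : E = (E `&` `[sigma, +oo[) `|` (E `&` `]-oo, sigma])); last first.
  rewrite -setIUr; apply/esym/setIidPl => s _ /=; rewrite !in_itv/= andbT.
  exact/orP/le_total.
rewrite (_ : 4 * delta = 2 * delta + 2 * delta); last by ring.
apply: (le_trans (measureU2 _ _ _)) => //; rewrite EFinD; apply: leeD.
  apply: lebesgue_small_diameter => // s s' [Es] /=; rewrite in_itv/= andbT => hs.
  move=> [Es'] /=; rewrite in_itv/= andbT => hs'.
  by have [ss'|s's] := leP s s'; [rewrite distrC ger0_norm ?subr_ge0//; exact: dEr
    |rewrite ger0_norm ?subr_ge0 ?(ltW s's)//; exact/dEr/ltW].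
apply: lebesgue_small_diameter => // s s' [Es] /=; rewrite in_itv/= => hs.
move=> [Es'] /=; rewrite in_itv/= => hs'.
by have [ss'|s's] := leP s s'; [rewrite distrC ger0_norm ?subr_ge0//; exact: dEl
  |rewrite ger0_norm ?subr_ge0 ?(ltW s's)//; exact/dEl/hs/ltW].
Qed.

Lemma measurable_shear (w : R) :
  measurable_fun setT (fun z : mR * mR => (z.1 - w * z.2, z.2) : mR * mR).
Proof.
apply: measurable_fun_pair; last exact: measurable_snd.
apply: measurable_funB; first exact: measurable_fst.
by apply: measurable_funM; [exact: measurable_cst|exact: measurable_snd].
Qed.

Let product_lebesgueC (S : set (mR * mR)) : measurable S ->
  (leb \x leb)%E S = (leb \x^ leb)%E S.
Proof.
by move: S; apply: product_measure_unique => //= *; rewrite product_measure2E.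
Qed.

(** Tonelli along the parallel lines z.1 + w z.2 = xi. At a fixed second coordinate the shear is a
    translation of the first, so it preserves area. For w = (a2 - b2) / (a1 - b1) these lines are
    orthogonal to a - b. *)
Lemma product_lebesgue_shear (w : R) (S : set (mR * mR)) : measurable S ->
  (leb \x leb)%E S =
  (\int[leb]_xi leb [set s : mR | S (((xi : R) - w * (s : R))%R, s)])%E.
Proof.
move=> mS.
pose S' := (fun z : mR * mR => (z.1 - w * z.2, z.2) : mR * mR) @^-1` S.
have mS' : measurable S'.
  by rewrite -[S']setTI; exact: (measurable_shear w).
transitivity ((leb \x leb)%E S'); last first.
  apply: eq_integral => xi _ /=; congr (leb _).
  by apply/seteqP; split => s /=; rewrite /xsection/= inE.
rewrite !product_lebesgueC//; apply: eq_integral => s _ /=.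
rewrite -(lebesgue_measure_translation (w * s)); last exact: measurable_ysection.
by congr (leb _); apply/seteqP; split => x /=; rewrite /ysection/= !inE.
Qed.

Lemma product_lebesgue_swap (S : set (mR * mR)) : measurable S ->
  (leb \x leb)%E S = (leb \x leb)%E [set z | S (z.2, z.1)].
Proof.
move=> mS; rewrite product_lebesgueC//; exact: eq_integral.
Qed.

(* An extended-real substitute for |u|^(-1/2) whose value at 0 is +oo. *)
Definition inv_sqrt_bound (u : R) : \bar R :=
  (1 + \sum_(k <oo) (2 ^+ k.+1 * (`|u| <= (4 ^+ k)^-1)%R%:R)%:E)%E.

Let term_ge0 (u : R) k : (0 <= (2 ^+ k.+1 * (`|u| <= (4 ^+ k)^-1)%R%:R)%:E :> \bar R)%E.
Proof. by rewrite lee_fin mulr_ge0// exprn_ge0. Qed.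

Lemma inv_sqrt_bound_ge1 u : (1 <= inv_sqrt_bound u)%E.
Proof. by rewrite leeDl// nneseries_ge0. Qed.

Lemma inv_sqrt_bound_ge0 u : (0 <= inv_sqrt_bound u)%E.
Proof. exact: le_trans (inv_sqrt_bound_ge1 u). Qed.

(** At 0 every layer is active and contributes at least 1. The infinite value makes pointwise bounds
    true on the degenerate line as well, so that no null set has to be discarded. *)
Lemma inv_sqrt_bound0 : inv_sqrt_bound 0 = +oo%E.
Proof.
apply/eqyP => A A0; apply: (@le_trans _ _ (\sum_(0 <= k < (Num.truncn A).+1)
    (2 ^+ k.+1 * (`|0 : R| <= (4 ^+ k)^-1)%R%:R)%:E)%E); last first.
  apply: (le_trans (nneseries_lim_ge (m := 0) (P := xpredT) _ _)) => //.
  by rewrite leeDr.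
rewrite sumEFin lee_fin; apply: (le_trans (ltW (truncnS_gt _))).
rewrite [leLHS](_ : _ = \sum_(0 <= k < (Num.truncn A).+1) 1); last first.
  by rewrite sumr_const_nat subn0.
apply: ler_sum => k _; rewrite normr0 invr_ge0 exprn_ge0// mulr1.
by rewrite exprn_ege1// ler1n.
Qed.

(** If 4^-(k+1) < |u| <= 4^-k, then |u|^(-1/2) < 2^(k+1), which is the term of index k. For |u| > 1
    the summand 1 suffices. *)
Lemma inv_sqrt_le_bound (u : R) : u != 0 ->
  (((Num.sqrt `|u|)^-1)%:E <= inv_sqrt_bound u)%E.
Proof.
move=> u0; have u_gt0 : 0 < `|u| by rewrite normr_gt0.
have s_gt0 : 0 < Num.sqrt `|u| by rewrite sqrtr_gt0.
have [u1|u1] := ltP 1 `|u|.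
  apply: le_trans (inv_sqrt_bound_ge1 u); rewrite lee_fin invf_le1//.
  by rewrite -sqrtr1 ler_wsqrtr// ltW.
have ex : exists k, (4 ^+ k)^-1 < `|u|.
  exists (Num.truncn `|u|^-1).+1; rewrite invf_plt ?posrE ?exprn_gt0//.
  apply: lt_le_trans (truncnS_gt _) _.
  by rewrite -natrX ler_nat ltnW// ltn_expl.
case: (ex_minnP ex) => -[|k] hk mk; first by move: hk; rewrite expr0 invr1 ltNge u1.
have uk : `|u| <= (4 ^+ k)^-1 by rewrite leNgt; apply/negP => /mk; rewrite ltnn.
apply: (@le_trans _ _ (2 ^+ k.+1 * (`|u| <= (4 ^+ k)^-1)%R%:R)%:E).
  rewrite uk mulr1 lee_fin invf_ple ?posrE ?exprn_gt0//.
  rewrite -[leLHS]ger0_norm ?invr_ge0 ?exprn_ge0// -sqrtr_sqr ler_wsqrtr//.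
  by rewrite exprVn -exprM mulnC exprM -[2 ^+ 2]natrX ltW.
apply: (@le_trans _ _ (\sum_(k <oo) (2 ^+ k.+1 * (`|u| <= (4 ^+ k)^-1)%R%:R)%:E)%E).
  apply: le_trans (nneseries_lim_ge (m := 0) (P := xpredT) k.+1 _) => //.
  by rewrite big_nat_recr//= leeDr// sume_ge0.
by rewrite leeDr.
Qed.

Let measurable_inv_sqrt_term (x0 : R) k : measurable_fun setT
  (fun x : mR => (2 ^+ k.+1 * (`|x - x0| <= (4 ^+ k)^-1)%R%:R)%:E : \bar R).
Proof.
apply/measurable_EFinP; apply: measurable_funM; first exact: measurable_cst.
have -> : (fun x : mR => (`|x - x0| <= (4 ^+ k)^-1)%R%:R : R) =
    \1_(`[x0 - (4 ^+ k)^-1, x0 + (4 ^+ k)^-1]%classic : set mR).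
  apply/funext => x; rewrite indicE; congr (_%:R : R); congr nat_of_bool.
  by rewrite mem_setE in_itv/= ler_distl.
exact: measurable_indic.
Qed.

Lemma measurable_inv_sqrt_bound (x0 : R) :
  measurable_fun setT (fun x : mR => inv_sqrt_bound (x - x0)).
Proof.
apply: emeasurable_funD; first exact: measurable_cst.
by apply: ge0_emeasurable_sum => // k _; exact: measurable_inv_sqrt_term.
Qed.

(** Layer k has height 2^(k+1) on an interval of length 2 * 4^-k, hence integral at most 4 / 2^k;
    these sum to 8. The summand 1 contributes b - a. *)
Lemma integral_inv_sqrt_bound (x0 a b : R) : a <= b ->
  (\int[leb]_(x in `[a, b]%classic) inv_sqrt_bound ((x : R) - x0)%R
     <= (b - a + 8)%:E)%E.
Proof.
move=> ab.
have mterm k : measurable_fun `[a, b]%classic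
    (fun x : mR => (2 ^+ k.+1 * (`|x - x0| <= (4 ^+ k)^-1)%R%:R)%:E : \bar R).
  by apply: measurable_funTS; exact: measurable_inv_sqrt_term.
rewrite ge0_integralD//; last 2 first.
  by move=> x _; rewrite nneseries_ge0.
  by apply: ge0_emeasurable_sum => // k _; exact: mterm.
rewrite EFinD; apply: leeD.
  rewrite integral_cst//= mul1e lebesgue_measure_itv/= lte_fin -EFinB.
  by case: ifP => _; rewrite lee_fin; lra.
rewrite integral_nneseries//.
apply: (@le_trans _ _ (\sum_(k <oo) (8 / (2 ^ (k + 1))%:R)%:E)%E); last first.
  have /cvg_lim := @cvg_geometric_eseries_half R 8 0.
  by rewrite expr0 divr1 => ->.
apply: lee_nneseries => [k _ _|k _]; first by apply: integral_ge0 => *.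
have q0 : 0 <= (4 ^+ k)^-1 :> R by rewrite invr_ge0 exprn_ge0.
pose I := `[x0 - (4 ^+ k)^-1, x0 + (4 ^+ k)^-1]%classic.
apply: (@le_trans _ _ ((2 ^+ k.+1)%:E * leb I)%E).
  rewrite integral_mkcond; apply: nonneg_integral_le_mul => //=.
  - exact: measurable_itv.
  - by move=> x; apply: erestrict_ge0 => *.
  - move=> x _; rewrite patchE; case: ifP => _; last by rewrite lee_fin exprn_ge0.
    by rewrite lee_fin ler_piMr ?exprn_ge0// lern1 leq_b1.
  - move=> x; rewrite /I /= in_itv/= -ler_distl => /negP/negbTE xk.
    by rewrite patchE xk mulr0; case: ifP.
rewrite /I lebesgue_measure_itv/= lte_fin -EFinB.
have -> : (8 / (2 ^ (k + 1))%:R : R) = 2 ^+ k.+1 * (2 * (4 ^+ k)^-1).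
  rewrite addn1 natrX !exprS.
  have -> : (4 ^+ k : R) = 2 ^+ k * 2 ^+ k by rewrite -exprMn -natrM.
  have : (2 ^+ k : R) != 0 by rewrite expf_neq0.
  by move: (2 ^+ k) => t t0; field; rewrite t0.
case: ifP => _; last by rewrite mule0 lee_fin mulr_ge0 ?exprn_ge0// mulr_ge0.
by rewrite -EFinM lee_fin ler_wpM2l ?exprn_ge0//; lra.
Qed.

(** Since |w| <= 1, only the lines with xi in [-1, 2] meet the unit square; 11 is the length 3 of
    this interval plus the 8 from the singularity at [xi0]. *)
Lemma product_lebesgue_shear_le (S : set (mR * mR)) (w c xi0 : R) :
  measurable S -> `|w| <= 1 -> 0 < c ->
  (forall x, S x -> 0 <= x.1 <= 1 /\ 0 <= x.2 <= 1) ->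
  (forall xi : R, xi != xi0 ->
    (leb [set s : mR | S ((xi - w * s)%R, s)] <= (c / Num.sqrt `|xi - xi0|)%:E)%E) ->
  ((leb \x leb) S <= (11 * c)%:E)%E.
Proof.
move=> mS w1 c0 S01 Sc; rewrite (product_lebesgue_shear w)//.
apply: (@le_trans _ _ (\int[leb]_(xi in [set` `[(- 1 : R)%R, (2 : R)%R]])
    (c%:E * inv_sqrt_bound ((xi : R) - xi0)%R))%E).
  rewrite [leRHS]integral_mkcond; apply: nonneg_le_integral => // xi.
  rewrite patchE; case: ifPn => [_|].
    have [->|xi0xi] := eqVneq (xi : R) xi0.
      by rewrite subrr inv_sqrt_bound0 gt0_muley ?lte_fin// leey.
    apply: (le_trans (Sc _ xi0xi)); rewrite EFinM lee_wpmul2l ?lee_fin ?(ltW c0)//.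
    by rewrite inv_sqrt_le_bound// subr_eq0.
  rewrite mem_setE in_itv/= => /negP xiN.
  rewrite (_ : [set _ | _] = set0) ?measure0//.
  apply/seteqP; split => // s /= /S01 /= [/andP[? ?] /andP[? ?]]; apply: xiN.
  move: w1; rewrite ler_norml => /andP[? ?]; apply/andP; split; nra.
rewrite ge0_integralZl//; last 3 first.
  by apply: measurable_funTS; exact: measurable_inv_sqrt_bound.
  by move=> x _; exact: inv_sqrt_bound_ge0.
  by rewrite lee_fin ltW.
rewrite [11 * c]mulrC EFinM lee_wpmul2l ?lee_fin ?(ltW c0)//.
apply: (le_trans (integral_inv_sqrt_bound _ _)); first by lra.
by rewrite lee_fin; lra.
Qed.

End plane.

(** * Level sets of a difference of two distances *)

Section plane_geometry.
Context {R : realType}.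
Local Notation mR := (measurableTypeR R).
Local Notation leb := (@lebesgue_measure R).

(* Rationalise: p - q = (p ^+ 2 - q ^+ 2) / (p + q), where the numerator is the
   same for both pairs. *)
Lemma root_difference_gap (p q p' q' S : R) :
  0 <= p <= S -> 0 <= q <= S -> 0 <= p' <= S -> 0 <= q' <= S ->
  p' ^+ 2 - q' ^+ 2 = p ^+ 2 - q ^+ 2 -> p ^+ 2 <= p' ^+ 2 ->
  `|p ^+ 2 - q ^+ 2| * (p' ^+ 2 - p ^+ 2) <=
  4 * S ^+ 3 * `|(p - q) - (p' - q')|.
Proof.
move=> /andP[p0 pS] /andP[q0 qS] /andP[p'0 p'S] /andP[q'0 q'S] DD pp'.
set D := p ^+ 2 - q ^+ 2; set h := p' ^+ 2 - p ^+ 2.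
have h0 : 0 <= h by rewrite /h subr_ge0.
have S0 : 0 <= S by exact: le_trans pS.
have lep : p <= p' by rewrite -(@ler_pXn2r _ 2).
have leq : q <= q' by rewrite -(@ler_pXn2r _ 2)//; move: DD pp'; lra.
have hp : h <= 2 * S * (p' - p).
  rewrite /h subr_sqr; nra.
have hq : h <= 2 * S * (q' - q).
  have -> : h = q' ^+ 2 - q ^+ 2 by rewrite /h; move: DD; lra.
  rewrite subr_sqr; nra.
set delta := (p - q) - (p' - q').
(* Both differences of roots have numerator D. Cross-multiplying gives a form free of division,
   where p + q may be 0. *)
have E : delta * ((p + q) * (p' + q')) = D * ((p' - p) + (q' - q)).
  have -> : delta * ((p + q) * (p' + q')) =
    (p ^+ 2 - q ^+ 2) * (p' + q') - (p' ^+ 2 - q' ^+ 2) * (p + q) by rewrite /delta; ring.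
  by rewrite DD /D; ring.
have pq0 : 0 <= (p + q) * (p' + q') by rewrite mulr_ge0 ?addr_ge0.
have pqS : (p + q) * (p' + q') <= 4 * S ^+ 2.
  rewrite (_ : 4 * S ^+ 2 = (2 * S) * (2 * S)); last by ring.
  by apply: ler_pM; rewrite ?addr_ge0//; lra.
have E2 : `|delta| * ((p + q) * (p' + q')) = `|D| * ((p' - p) + (q' - q)).
  rewrite -[X in _ * X = _]ger0_norm// -normrM E normrM; congr (_ * _).
  by rewrite ger0_norm// addr_ge0// subr_ge0.
have : `|D| * (2 * h) <= `|D| * (2 * S * ((p' - p) + (q' - q))).
  by rewrite ler_wpM2l//; lra.
have -> : `|D| * (2 * S * ((p' - p) + (q' - q))) =
    2 * S * (`|delta| * ((p + q) * (p' + q'))) by rewrite E2; ring.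
have : 2 * S * (`|delta| * ((p + q) * (p' + q'))) <= 2 * S * (`|delta| * (4 * S ^+ 2)).
  by rewrite ler_wpM2l// ?mulr_ge0// ler_wpM2l.
rewrite (_ : 2 * S * (`|delta| * (4 * S ^+ 2)) = 2 * (4 * S ^+ 3 * `|delta|)); last by ring.
rewrite (_ : `|D| * (2 * h) = 2 * (`|D| * h)); last by ring.
by move=> ? ?; lra.
Qed.

(** [A] stands for the squared distance in the coordinates held fixed outside the plane. *)
Definition sqdist (A a1 a2 : R) (z : R * R) : R :=
  A + (z.1 - a1) ^+ 2 + (z.2 - a2) ^+ 2.

(** The determinant of a - b and z - a, which vanishes when a, b and z are collinear in the
    plane. *)
Definition cross (a1 a2 b1 b2 : R) (z : R * R) : R :=
  (a1 - b1) * (z.2 - a2) - (a2 - b2) * (z.1 - a1).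

(* The derivative of |x - a| - |x - b| along the direction orthogonal to a - b
   vanishes where x is collinear with a and b and where x is equidistant from
   them; [slope_weight] measures the distance to both degeneracies.  The exponents
   1/2 and 1 are those for which the sublevel sets, and the level sets restricted
   to a superlevel set, both have linearly bounded measure. *)
Definition slope_weight (A B a1 a2 b1 b2 : R) (z : R * R) : R :=
  let rho := Num.max `|a1 - b1| `|a2 - b2| in
  Num.sqrt (`|sqdist A a1 a2 z - sqdist B b1 b2 z| / rho)
    * (`|cross a1 a2 b1 b2 z| / rho).

Section line.
Variables A B a1 a2 b1 b2 : R.
Hypotheses (ab1 : a1 != b1) (ab2 : `|a2 - b2| <= `|a1 - b1|).

(** The point (xi - w s, s) runs along a line with direction (-w, 1), orthogonal to a - b, and q is
    the squared length of that direction. [xi0] is the line equidistant from a and b, offsets [A]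
    and [B] included; [sigma xi] is the parameter of the foot, which a and b share. *)
Let w := (a2 - b2) / (a1 - b1).
Let q := 1 + w ^+ 2.
Let rho := `|a1 - b1|.
Let xi0 := (a1 + b1 + w * (a2 + b2)) / 2 + (A - B) / (2 * (a1 - b1)).
Let sigma (xi : R) := (a2 + w * (xi - a1)) / q.

Let q_ge1 : 1 <= q. Proof. by rewrite /q lerDl sqr_ge0. Qed.
Let q_gt0 : 0 < q. Proof. exact: lt_le_trans q_ge1. Qed.
Let q_neq0 : q != 0. Proof. by rewrite gt_eqF. Qed.
Let ab_neq0 : a1 - b1 != 0. Proof. by rewrite subr_eq0. Qed.
Let rho_gt0 : 0 < rho. Proof. by rewrite normr_gt0. Qed.
Let maxE : Num.max `|a1 - b1| `|a2 - b2| = rho.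
Proof. by apply/max_idPl. Qed.
Let a2b2 : a2 - b2 = w * (a1 - b1).
Proof. by rewrite /w mulfVK. Qed.

Let sqdistB xi s : sqdist A a1 a2 (xi - w * s, s) - sqdist B b1 b2 (xi - w * s, s)
  = - (2 * (a1 - b1) * (xi - xi0)).
Proof.
rewrite /sqdist /xi0 /=.
have -> : b2 = a2 - w * (a1 - b1) by rewrite -a2b2; ring.
by move: w => w'; field; exact: ab_neq0.
Qed.

Let crossE xi s : cross a1 a2 b1 b2 (xi - w * s, s) = (a1 - b1) * q * (s - sigma xi).
Proof.
rewrite /cross /sigma /= a2b2.
have -> : (a1 - b1) * q * (s - (a2 + w * (xi - a1)) / q) =
  (a1 - b1) * (q * s - (a2 + w * (xi - a1))) by field.
by rewrite /q; ring.
Qed.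

Let sqdist_moveE xi s s' : sqdist A a1 a2 (xi - w * s', s') - sqdist A a1 a2 (xi - w * s, s)
  = q * ((s' - sigma xi) ^+ 2 - (s - sigma xi) ^+ 2).
Proof.
have -> : q * ((s' - sigma xi) ^+ 2 - (s - sigma xi) ^+ 2) =
   q * (s' - s) * (s' + s) - 2 * (s' - s) * (q * sigma xi) by ring.
have -> : q * sigma xi = a2 + w * (xi - a1) by rewrite /sigma; field.
by rewrite /q /sqdist /=; ring.
Qed.

(** On one line the first factor of the weight is constant and the second is proportional to the
    distance from the foot. *)
Let weightE xi s : slope_weight A B a1 a2 b1 b2 (xi - w * s, s) =
  Num.sqrt (2 * `|xi - xi0|) * (q * `|s - sigma xi|).
Proof.
rewrite /slope_weight maxE sqdistB crossE normrN !normrM (ger0_norm (ltW q_gt0)).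
rewrite -/rho ger0_norm//; congr (Num.sqrt _ * _); field; exact: lt0r_neq0.
Qed.

Let kappa_ge (u : R) : Num.sqrt u <= Num.sqrt (2 * u).
Proof.
have [u0|u0] := leP 0 u; first by rewrite ler_wsqrtr//; lra.
by rewrite (ltr0_sqrtr u0) sqrtr_ge0.
Qed.

(** The formula for the weight and q >= 1 confine s to distance v / sqrt |xi - xi0| from the
    foot. *)
Lemma line_sublevel (v : R) (E : set mR) (xi : R) : measurable E -> 0 <= v ->
  xi != xi0 ->
  (forall s, E s -> slope_weight A B a1 a2 b1 b2 (xi - w * s, s) <= v) ->
  (leb E <= (4 * v / Num.sqrt `|xi - xi0|)%:E)%E.
Proof.
move=> mE v0 xixi0 hE.
have k0 : 0 < Num.sqrt `|xi - xi0| by rewrite sqrtr_gt0 normr_gt0 subr_eq0.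
have hE' s : E s -> `|s - sigma xi| <= v / Num.sqrt `|xi - xi0|.
  move=> /hE; rewrite weightE => h; rewrite ler_pdivlMr// mulrC.
  apply: le_trans h; apply: ler_pM => //.
  by rewrite ler_peMl.
rewrite -mulrA; apply: (@lebesgue_small_diameter_sides _ _ (sigma xi)) => //.
- by rewrite divr_ge0// ltW.
- by move=> s s' Es /hE' + ? ?; rewrite ler_norml => /andP[? ?]; lra.
- by move=> s s' Es /hE' + ? ?; rewrite ler_norml => /andP[? ?]; lra.
Qed.

(** Let u <= u' be the distances of two points from the foot and k = sqrt (2 |xi - xi0|). The gap
    lemma for roots gives rho k^2 q (u'^2 - u^2) <= 4 S^3 eps. Here u' + u >= 2 u, and k q u is the
    weight of the nearer point, hence at least m. So u' - u <= 2 S^3 eps / (rho m k), and the two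
    sides of the foot multiply this by 4. *)
Lemma line_level (S y eps m : R) (E : set mR) (xi : R) : measurable E ->
  0 < eps -> 0 < m -> 0 <= S -> 0 <= A -> 0 <= B -> xi != xi0 ->
  (forall s, E s -> [/\ sqdist A a1 a2 (xi - w * s, s) <= S ^+ 2,
     sqdist B b1 b2 (xi - w * s, s) <= S ^+ 2,
     y <= Num.sqrt (sqdist A a1 a2 (xi - w * s, s))
         - Num.sqrt (sqdist B b1 b2 (xi - w * s, s)) <= y + eps &
     m <= slope_weight A B a1 a2 b1 b2 (xi - w * s, s)]) ->
  (leb E <= (8 * S ^+ 3 * eps / (rho * m) / Num.sqrt `|xi - xi0|)%:E)%E.
Proof.
move=> mE eps0 m0 S0 A0 B0 xixi0 hE.
have x0 : 0 < `|xi - xi0| by rewrite normr_gt0 subr_eq0.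
have k0 : 0 < Num.sqrt `|xi - xi0| by rewrite sqrtr_gt0.
have sq0 C c1 c2 z : 0 <= C -> 0 <= sqdist C c1 c2 z.
  by move=> C0; rewrite /sqdist !addr_ge0// sqr_ge0.
have rt C c1 c2 z : 0 <= C -> sqdist C c1 c2 z <= S ^+ 2 ->
    0 <= Num.sqrt (sqdist C c1 c2 z) <= S.
  move=> C0 zS; rewrite sqrtr_ge0/= -(ger0_norm S0) -sqrtr_sqr.
  exact: ler_wsqrtr.
pose delta := 2 * S ^+ 3 * eps / (rho * m) / Num.sqrt `|xi - xi0|.
have gap s s' : E s -> E s' -> `|s - sigma xi| <= `|s' - sigma xi| ->
    `|s' - sigma xi| - `|s - sigma xi| <= delta.
  move=> /hE[aS bS /andP[y1 y2] ms] /hE[aS' bS' /andP[y1' y2'] ms'] ss'.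
  have D1 := sqdistB xi s; have D2 := sqdistB xi s'.
  have H := sqdist_moveE xi s s'.
  have hle : (s - sigma xi) ^+ 2 <= (s' - sigma xi) ^+ 2.
    by rewrite -[leLHS]real_normK ?num_real// -[leRHS]real_normK ?num_real// ler_pXn2r ?nnegrE.
  have := @root_difference_gap _ _ _ _ S (rt _ _ _ _ A0 aS) (rt _ _ _ _ B0 bS)
     (rt _ _ _ _ A0 aS') (rt _ _ _ _ B0 bS').
  rewrite !sqr_sqrtr ?sq0// D1 D2 => /(_ erefl); rewrite -subr_ge0 H.
  move=> /(_ (mulr_ge0 (ltW q_gt0) _)); rewrite subr_ge0 => /(_ hle).
  set dF := `|_ - _ - _| => gapH.
  have dFe : dF <= eps by rewrite /dF ler_norml; apply/andP; split; lra.
  set u := `|s - sigma xi| in ss' *; set u' := `|s' - sigma xi| in ss' *.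
  have u0 : 0 <= u by exact: normr_ge0.
  move: gapH; rewrite normrN normrM normrM -/rho ger0_norm//.
  rewrite -[(s - _) ^+ 2]real_normK ?num_real// -[(s' - _) ^+ 2]real_normK ?num_real//.
  rewrite -/u -/u' => gapH.
  move: ms; rewrite weightE -/u; set k := Num.sqrt (2 * _) => ms.
  have kk : k ^+ 2 = 2 * `|xi - xi0| by rewrite sqr_sqrtr// mulr_ge0.
  have kge : Num.sqrt `|xi - xi0| <= k by exact: kappa_ge.
  have kgt0 : 0 < k by exact: lt_le_trans kge.
  have G1 : rho * k ^+ 2 * (q * (u' ^+ 2 - u ^+ 2)) <= 4 * S ^+ 3 * eps.
    apply: (@le_trans _ _ (4 * S ^+ 3 * dF)).
      by rewrite kk; move: gapH; rewrite (mulrC 2 rho) mulrA.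
    by rewrite ler_wpM2l// mulr_ge0// exprn_ge0.
  have G2 : 2 * rho * k * (u' - u) * m <= rho * k ^+ 2 * (q * (u' ^+ 2 - u ^+ 2)).
    apply: (@le_trans _ _ (2 * rho * k * (u' - u) * (k * (q * u)))).
      rewrite ler_wpM2l//; do 3?[apply: mulr_ge0 => //]; rewrite ?subr_ge0//; exact: ltW.
    rewrite subr_sqr.
    have -> : rho * k ^+ 2 * (q * ((u' - u) * (u' + u))) =
       rho * k ^+ 2 * q * (u' - u) * (u' + u) by ring.
    have -> : 2 * rho * k * (u' - u) * (k * (q * u)) =
       rho * k ^+ 2 * q * (u' - u) * (2 * u) by ring.
    rewrite ler_wpM2l//; last by lra.
    by do 3?[apply: mulr_ge0 => //]; rewrite ?subr_ge0 ?exprn_ge0//; exact: ltW.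
  have G3 : 2 * rho * Num.sqrt `|xi - xi0| * (u' - u) * m <= 4 * S ^+ 3 * eps.
    apply: le_trans (le_trans G2 G1).
    by rewrite ler_wpM2r ?(ltW m0)// ler_wpM2r ?subr_ge0// ler_wpM2l// mulr_ge0// ltW.
  rewrite /delta ler_pdivlMr// ler_pdivlMr; last exact: mulr_gt0.
  by move: G3; lra.
rewrite (_ : 8 * _ * _ / _ / _ = 4 * delta); last by rewrite /delta; ring.
have delta0 : 0 <= delta.
  by rewrite !divr_ge0 ?mulr_ge0 ?exprn_ge0 ?sqrtr_ge0// ltW.
apply: (@lebesgue_small_diameter_sides _ _ (sigma xi)) => //.
- move=> s s' Es Es' ss ss'; have := gap _ _ Es Es'.
  by rewrite !ger0_norm ?subr_ge0//; [move=> /(_ (lerB ss' (lexx _))); lra|lra].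
- move=> s s' Es Es' ss ss'; have := gap _ _ Es Es'.
  by rewrite !ler0_norm ?subr_le0//; [move=> /(_ ltac:(lra)); lra|lra].
Qed.

End line.
End plane_geometry.

(** * Sublevel and level sets in the unit square *)

Section plane_measure.
Context {R : realType}.
Local Notation mR := (measurableTypeR R).
Local Notation leb := (@lebesgue_measure R).
Local Notation plane := (mR * mR)%type.

Lemma slope_weight_swap (A B a1 a2 b1 b2 : R) z :
  slope_weight A B a1 a2 b1 b2 (z.2, z.1) = slope_weight A B a2 a1 b2 b1 z.
Proof.
rewrite /slope_weight maxC; congr (Num.sqrt (`|_| / _) * (_ / _)).
  by rewrite /sqdist /=; ring.
by rewrite -normrN /cross /=; congr `|_|; ring.
Qed.

Lemma sqdist_swap (A a1 a2 : R) z : sqdist A a1 a2 (z.2, z.1) = sqdist A a2 a1 z.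
Proof. by rewrite /sqdist /=; ring. Qed.

Lemma measurable_setX_swap (S : set plane) : measurable S ->
  measurable [set z : plane | S (z.2, z.1)].
Proof.
move=> mS; rewrite -[X in measurable X]setTI.
apply: (measurable_fun_pair (f := snd : plane -> mR) (g := fst : plane -> mR)) => //.
Qed.

Let neq_fst (a1 a2 b1 b2 : R) : (a1, a2) <> (b1, b2) ->
  `|a2 - b2| <= `|a1 - b1| -> a1 != b1.
Proof.
move=> nab ab; apply/eqP => ab1; apply: nab; move: ab.
by rewrite ab1 subrr normr0 normr_le0 subr_eq0 => /eqP->.
Qed.

Let slope_le1 (a1 a2 b1 b2 : R) : a1 != b1 ->
  `|a2 - b2| <= `|a1 - b1| -> `|(a2 - b2) / (a1 - b1)| <= 1.
Proof.
by move=> ab1 ab; rewrite normrM normfV ler_pdivrMr ?normr_gt0 ?subr_eq0// mul1r.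
Qed.

Let measurable_shear_section (w xi : R) (S : set plane) : measurable S ->
  measurable [set s : mR | S (xi - w * s, s)].
Proof.
move=> mS; rewrite -[X in measurable X]setTI.
apply: (measurable_fun_pair (f := fun s : mR => xi - w * s : mR) (g := id)) => //.
by apply: measurable_funB; [exact: measurable_cst|apply: measurable_funM].
Qed.

(** Exchanging the two coordinates preserves area and weight, so the lines may be assumed to have
    |w| <= 1. The constant 44 is 11 * 4, from the integration over lines and from the bound on one
    line. *)
Lemma plane_sublevel (A B a1 a2 b1 b2 v : R) (S : set plane) :
  measurable S -> (a1, a2) <> (b1, b2) -> 0 < v ->
  (forall z, S z -> 0 <= z.1 <= 1 /\ 0 <= z.2 <= 1) ->
  (forall z, S z -> slope_weight A B a1 a2 b1 b2 z <= v) ->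
  ((leb \x leb) S <= (44 * v)%:E)%E.
Proof.
wlog ab : a1 a2 b1 b2 S / `|a2 - b2| <= `|a1 - b1| => [wl|] mS nab v0 S01 Sv.
  have [ab|/ltW ba] := leP `|a2 - b2| `|a1 - b1|; first exact: (wl a1 a2 b1 b2).
  rewrite product_lebesgue_swap//; apply: (wl a2 a1 b2 b1) => //.
  - exact: measurable_setX_swap.
  - by move=> [ba2 ba1]; apply: nab; rewrite ba1 ba2.
  - by move=> z /= /S01[].
  - by move=> z /= /Sv; rewrite slope_weight_swap.
have ab1 := neq_fst nab ab.
rewrite (_ : 44 * v = 11 * (4 * v)); last by ring.
apply: (product_lebesgue_shear_le mS (slope_le1 ab1 ab) _ S01); first by rewrite mulr_gt0.
move=> xi xixi0; apply: (@line_sublevel _ A B _ _ _ _ ab1 ab _ _ _ _ (ltW v0) xixi0).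
- exact: measurable_shear_section.
- by move=> s /Sv.
Qed.

Lemma plane_level (A B a1 a2 b1 b2 L y eps m : R) (S : set plane) :
  measurable S -> (a1, a2) <> (b1, b2) ->
  0 < eps -> 0 < m -> 0 < L -> 0 <= A -> 0 <= B ->
  (forall z, S z -> 0 <= z.1 <= 1 /\ 0 <= z.2 <= 1) ->
  (forall z, S z -> [/\ sqdist A a1 a2 z <= L ^+ 2, sqdist B b1 b2 z <= L ^+ 2,
     y <= Num.sqrt (sqdist A a1 a2 z) - Num.sqrt (sqdist B b1 b2 z) <= y + eps &
     m <= slope_weight A B a1 a2 b1 b2 z]) ->
  ((leb \x leb) S <=
    (88 * L ^+ 3 * eps / (Num.max `|a1 - b1| `|a2 - b2| * m))%:E)%E.
Proof.
wlog ab : a1 a2 b1 b2 S / `|a2 - b2| <= `|a1 - b1| => [wl|].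
  move=> mS nab eps0 m0 L0 A0 B0 S01 Sv.
  have [ab|/ltW ba] := leP `|a2 - b2| `|a1 - b1|.
    rewrite -[X in _ / (X * _)](max_idPl ab); exact: (wl a1 a2 b1 b2).
  rewrite -[X in _ / (X * _)](max_idPl ba).
  rewrite product_lebesgue_swap//; apply: (wl a2 a1 b2 b1) => //.
  - exact: measurable_setX_swap.
  - by move=> [ba2 ba1]; apply: nab; rewrite ba1 ba2.
  - by move=> z /= /S01[].
  - by move=> z /= /Sv; rewrite slope_weight_swap !sqdist_swap.
move=> mS nab eps0 m0 L0 A0 B0 S01 Sv.
have ab1 := neq_fst nab ab.
rewrite (max_idPl ab) (_ : 88 * _ * _ / _ =
  11 * (8 * L ^+ 3 * eps / (`|a1 - b1| * m))); last by ring.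
apply: (product_lebesgue_shear_le mS (slope_le1 ab1 ab) _ S01).
  by rewrite !(mulr_gt0, invr_gt0)// ?exprn_gt0// normr_gt0 subr_eq0.
move=> xi xixi0.
apply: (line_level (y := y) ab1 ab _ eps0 m0 (ltW L0) A0 B0 xixi0).
- exact: measurable_shear_section.
- by move=> s /Sv.
Qed.

End plane_measure.

(** * From the plane to the cube *)

Section tuple_slices.
Context {R : realType}.
Local Notation mR := (measurableTypeR R).
Local Notation leb := (@lebesgue_measure R).
Local Open Scope ereal_scope.

Lemma integral_lebesgue_tupleS d (h : Rpoint R d.+1 -> \bar R) :
  measurable_fun setT h -> (forall p, 0 <= h p) ->
  \int[lebesgue_tuple d.+1]_p h p =
  \int[leb]_x \int[lebesgue_tuple d]_p h (pcons (x, p)).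
Proof.
move=> mh h0.
rewrite [LHS](@ge0_integral_pushforward _ _ _ _ R _ (@measurable_pcons R d))//.
rewrite preimage_setT fubini_tonelli1//.
  by apply: measurableT_comp => //; exact: measurable_pcons.
by move=> z; exact: h0.
Qed.

Lemma integral_lebesgue_tuple2 (h : Rpoint R 2 -> \bar R) :
  measurable_fun setT h -> (forall p, 0 <= h p) ->
  \int[lebesgue_tuple 2]_p h p = \int[leb]_x \int[leb]_y h [tuple x; y].
Proof.
move=> mh h0; rewrite integral_lebesgue_tupleS//; apply: eq_integral => x _.
have mhx : measurable_fun setT (fun p : Rpoint R 1 => h (pcons (x, p))).
  apply: measurableT_comp => //; apply: measurableT_comp; first exact: measurable_pcons.
  exact: measurable_pair1.
rewrite integral_lebesgue_tupleS//; apply: eq_integral => y _.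
rewrite integral_dirac//; last first.
  apply: (measurableT_comp mhx); apply: measurableT_comp; first exact: measurable_pcons.
  exact: measurable_pair1.
rewrite diracT mul1e; congr h; exact: val_inj.
Qed.

Lemma leb01 : leb [set` `[0%R : R, 1%R]] = 1.
Proof. by rewrite lebesgue_measure_itv/= lte_fin ltr01 sube0. Qed.

(** Integrating over each leading coordinate preserves a uniform bound on the plane integrals,
    because the integrand lives on [0, 1], of measure 1. *)
Lemma integral_lebesgue_tuple_slice d (h : Rpoint R (d + 2) -> \bar R) (K : R) :
  measurable_fun setT h -> (forall p, 0 <= h p) -> (0 <= K)%R ->
  (forall p, ~ unit_cube p -> h p = 0) ->
  (forall t : Rpoint R d,
     \int[leb]_x \int[leb]_y h [tuple of t ++ [tuple x; y]] <= K%:E) ->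
  \int[lebesgue_tuple (d + 2)]_p h p <= K%:E.
Proof.
elim: d => [|d IH] in h * => mh h0 K0 hcube hK.
  rewrite integral_lebesgue_tuple2//; apply: le_trans (hK [tuple]).
  by rewrite le_eqVlt; apply/orP; left; apply/eqP/eq_integral => x _; apply/eq_integral => y _;
    congr h; exact: val_inj.
rewrite (@integral_lebesgue_tupleS (d + 2) h)//.
rewrite -[leRHS]mule1 -leb01.
have pcube x p : @unit_cube R (d + 2).+1 (pcons (x, p)) -> (0 <= x <= 1)%R /\ unit_cube p.
  move=> H; split; first exact: (H ord0).
  by move=> j; have := H (lift ord0 j); rewrite tnthS.
apply: (@nonneg_integral_le_mul _ mR R leb
  (fun x => \int[lebesgue_tuple (d + 2)]_p h (pcons (x, p))) K%:E
  [set` `[0%R : R, 1%R]]) => //.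
- by move=> x; apply: integral_ge0.
- move=> x _; apply: IH => //.
  + apply: measurableT_comp => //; apply: measurableT_comp; first exact: measurable_pcons.
    exact: measurable_pair1.
  + by move=> p np; apply: hcube => /pcube[].
  + move=> t; apply: le_trans (hK [tuple of x :: t]).
    rewrite le_eqVlt; apply/orP; left; apply/eqP/eq_integral => x' _; apply/eq_integral => y _.
    congr h; exact: val_inj.
- move=> x /=; rewrite in_itv/= => xN; apply: integral0_eq => p _; apply: hcube.
  by move=> /pcube[].
Qed.

Lemma measurable_cat_pair d (t : Rpoint R d) :
  measurable_fun setT (fun z : mR * mR =>
    [tuple of t ++ [tuple z.1; z.2]] : Rpoint R (d + 2)).
Proof.
apply/measurable_fun_tnthP => i.
rewrite (_ : _ \o _ = fun z : mR * mR => match fintype.split i with inl j => tnth t j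
   | inr j => tnth [tuple z.1; z.2] j end).
  case: (fintype.split i) => j; first exact: measurable_cst.
  have [->|j0] := eqVneq j ord0; first exact: measurable_fst.
  rewrite (_ : (fun _ => _) = snd); first exact: measurable_snd.
  by apply/funext => z; case: j j0 => -[|[|]].
apply/funext => z /=; rewrite -{1}(splitK i).
by case: (fintype.split i) => j /=; rewrite ?tnth_lshift ?tnth_rshift.
Qed.

Lemma measurable_slice d (t : Rpoint R d) (A : set (Rpoint R (d + 2))) :
  measurable A ->
  measurable [set z : mR * mR | A [tuple of t ++ [tuple z.1; z.2]]].
Proof.
by move=> mA; rewrite -[X in measurable X]setTI; exact: (measurable_cat_pair t).
Qed.

Lemma lebesgue_tuple_slice d (A : set (Rpoint R (d + 2))) (K : R) :
  measurable A -> (0 <= K)%R -> A `<=` unit_cube ->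
  (forall t : Rpoint R d,
     (leb \x leb) [set z | A [tuple of t ++ [tuple z.1; z.2]]] <= K%:E) ->
  lebesgue_tuple (d + 2) A <= K%:E.
Proof.
move=> mA K0 Acube AK.
rewrite -(setIT A) -integral_indic//; apply: integral_lebesgue_tuple_slice => //.
- exact/measurable_EFinP/measurable_indic.
- by move=> p np; rewrite indicE memNset// => /Acube.
- move=> t; apply: le_trans (AK t).
  rewrite le_eqVlt; apply/orP; left; apply/eqP/eq_integral => x _.
  have mB : measurable [set y : mR | A [tuple of t ++ [tuple x; y]]].
    have := measurable_xsection x (measurable_slice t mA).
    by congr measurable; apply/seteqP; split => y; rewrite /xsection/= inE.
  rewrite /= (_ : xsection _ _ = [set y : mR | A [tuple of t ++ [tuple x; y]]]); last first.
    by apply/seteqP; split => y; rewrite /xsection/= inE.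
  by rewrite -[in RHS](setIT [set y | _]) -integral_indic//; apply: eq_integral => y _.
Qed.

End tuple_slices.

Section tuple_geometry.
Context {R : realType} {d : nat}.
Local Notation mR := (measurableTypeR R).
Local Notation leb := (@lebesgue_measure R).
Local Notation point := (Rpoint R (d + 2)).
Implicit Types (a b x : point).

(* The last two coordinates span the plane because [lebesgue_tuple] integrates
   the leading coordinates outermost. *)
Definition plane_fst x : R := tnth x (rshift d ord0).
Definition plane_snd x : R := tnth x (rshift d ord_max).

Definition sqnorm2 (p q : point) : R :=
  \sum_(j < d + 2) ((tnth p j : R) - tnth q j) ^+ 2.

(** The [rho] of the planar estimates: the lines stay in a plane parallel to the last two axes, so
    only this projection of a - b matters. *)
Definition plane_gap a b : R :=
  Num.max `|plane_fst a - plane_fst b| `|plane_snd a - plane_snd b|.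

Definition weight a b x : R :=
  Num.sqrt (`|sqnorm2 x a - sqnorm2 x b| / plane_gap a b)
    * (`|cross (plane_fst a) (plane_snd a) (plane_fst b) (plane_snd b)
          (plane_fst x, plane_snd x)| / plane_gap a b).

Definition prefix_sqnorm2 (t : Rpoint R d) a : R :=
  \sum_(j < d) ((tnth t j : R) - tnth a (lshift 2 j)) ^+ 2.

Let plane_fst_cat (t : Rpoint R d) (u v : R) :
  plane_fst [tuple of t ++ [tuple u; v]] = u.
Proof. by rewrite /plane_fst tnth_rshift. Qed.

Let plane_snd_cat (t : Rpoint R d) (u v : R) :
  plane_snd [tuple of t ++ [tuple u; v]] = v.
Proof. by rewrite /plane_snd tnth_rshift. Qed.

Let sqnorm2_cat (t : Rpoint R d) (u v : R) a :
  sqnorm2 [tuple of t ++ [tuple u; v]] a =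
  sqdist (prefix_sqnorm2 t a) (plane_fst a) (plane_snd a) (u, v).
Proof.
rewrite /sqnorm2 big_split_ord/= /sqdist -addrA; congr (_ + _).
  by apply: eq_bigr => j _; rewrite tnth_lshift.
rewrite !big_ord_recl big_ord0 addr0 !tnth_rshift/=.
by congr (_ + _ ^+ 2); congr (_ - tnth _ (rshift _ _)); exact: val_inj.
Qed.

Let weight_cat (t : Rpoint R d) (u v : R) a b :
  weight a b [tuple of t ++ [tuple u; v]] =
  slope_weight (prefix_sqnorm2 t a) (prefix_sqnorm2 t b)
    (plane_fst a) (plane_snd a) (plane_fst b) (plane_snd b) (u, v).
Proof. by rewrite /weight !sqnorm2_cat plane_fst_cat plane_snd_cat. Qed.

Lemma sqnorm2_cube_le (p q : point) : unit_cube p -> unit_cube q ->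
  sqnorm2 p q <= Num.sqrt (d + 2)%:R ^+ 2.
Proof.
move=> hp hq; rewrite sqr_sqrtr ?ler0n//.
rewrite [leRHS](_ : _ = \sum_(j < d + 2) 1); last by rewrite sumr_const card_ord.
apply: ler_sum => j _.
by have /andP[? ?] := hp j; have /andP[? ?] := hq j; nra.
Qed.

Let plane_cube (t : Rpoint R d) (u v : R) : unit_cube [tuple of t ++ [tuple u; v]] ->
  0 <= u <= 1 /\ 0 <= v <= 1.
Proof.
move=> h; split; first by have := h (rshift d ord0); rewrite tnth_rshift.
by have := h (rshift d ord_max); rewrite tnth_rshift.
Qed.

Let gap_neq a b : 0 < plane_gap a b ->
  (plane_fst a, plane_snd a) <> (plane_fst b, plane_snd b).
Proof.
by rewrite /plane_gap => /[swap] -[-> ->]; rewrite !subrr normr0 maxxx ltxx.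
Qed.

Lemma weight_sublevel a b (v : R) (A : set point) : measurable A ->
  0 < plane_gap a b -> 0 < v -> A `<=` unit_cube ->
  (forall x, A x -> weight a b x <= v) ->
  (lebesgue_tuple (d + 2) A <= (44 * v)%:E)%E.
Proof.
move=> mA gab v0 Acube Av; apply: lebesgue_tuple_slice => //.
  by rewrite mulr_ge0// ltW.
move=> t; apply: (@plane_sublevel _ (prefix_sqnorm2 t a) (prefix_sqnorm2 t b)
  (plane_fst a) (plane_snd a) (plane_fst b) (plane_snd b)) => //.
- exact: measurable_slice.
- exact: gap_neq.
- by move=> z /Acube/plane_cube.
- by move=> z /Av; rewrite weight_cat; case: z.
Qed.

Lemma weight_level a b (y eps m : R) (A : set point) : measurable A ->
  0 < plane_gap a b -> 0 < eps -> 0 < m -> unit_cube a -> unit_cube b ->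
  A `<=` unit_cube ->
  (forall x, A x -> y <= dist2 x a - dist2 x b <= y + eps /\ m <= weight a b x) ->
  (lebesgue_tuple (d + 2) A <=
    (88 * Num.sqrt (d + 2)%:R ^+ 3 * eps / (plane_gap a b * m))%:E)%E.
Proof.
move=> mA gab eps0 m0 ca cb Acube Av.
have L0 : 0 < Num.sqrt (d + 2)%:R :> R by rewrite sqrtr_gt0 ltr0n addn2.
apply: lebesgue_tuple_slice => //.
  by rewrite divr_ge0 ?mulr_ge0 ?exprn_ge0// ltW.
move=> t; apply: (@plane_level _ (prefix_sqnorm2 t a) (prefix_sqnorm2 t b)
  (plane_fst a) (plane_snd a) (plane_fst b) (plane_snd b) _ y) => //.
- exact: measurable_slice.
- exact: gap_neq.
- by rewrite sumr_ge0// => *; exact: sqr_ge0.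
- by rewrite sumr_ge0// => *; exact: sqr_ge0.
- by move=> z /Acube/plane_cube.
- move=> [z1 z2] /= Az; have cz := Acube _ Az.
  have [Az1 Az2] := Av _ Az; split.
  + by rewrite -sqnorm2_cat; exact: sqnorm2_cube_le.
  + by rewrite -sqnorm2_cat; exact: sqnorm2_cube_le.
  + by rewrite -!sqnorm2_cat.
  + by rewrite -weight_cat.
Qed.

Lemma measurable_unit_cube k : measurable (@unit_cube R k).
Proof.
rewrite (_ : unit_cube = \bigcap_(j in [set: 'I_k]) [set p | 0 <= (tnth p j : R) <= 1]).
  apply: fin_bigcap_measurable => // j _; rewrite -[X in measurable X]setTI.
  have := @measurable_tnth _ mR k j measurableT `[0, 1]%classic (measurable_itv _).
  by congr measurable; apply/seteqP; split => p /=; rewrite in_itv.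
by apply/seteqP; split => [p h j _|p h j]; exact: h.
Qed.

Lemma lebesgue_unit_cube_le1 : (lebesgue_tuple (d + 2) (@unit_cube R (d + 2)) <= 1)%E.
Proof.
apply: lebesgue_tuple_slice => //; first exact: measurable_unit_cube.
move=> t; apply: (@le_trans _ _ ((leb \x leb) ([set` `[0%R : R, 1%R]] `*` [set` `[0%R : R, 1%R]]))%E).
  apply: le_measure; rewrite ?inE.
  - by apply: measurable_slice; exact: measurable_unit_cube.
  - by apply: measurableX.
  - by move=> z /plane_cube[? ?]; split; rewrite /= in_itv.
by rewrite [leLHS]product_measure1E//= leb01 mule1.
Qed.

End tuple_geometry.

(** * Measurability of distances and of comparisons *)

Section measurable_comparison.
Context {disp : measure_display} {T : measurableType disp} {R : realType}.
Local Notation mR := (measurableTypeR R).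

Lemma measurable_le_set (f g : T -> mR) : measurable_fun setT f ->
  measurable_fun setT g -> measurable [set x | (f x : R) <= g x].
Proof.
move=> mf mg; have := measurable_fun_ler mf mg measurableT (Y := [set true]) Logic.I.
by rewrite setTI; congr measurable; apply/seteqP; split.
Qed.

Lemma measurable_lt_set (f g : T -> mR) : measurable_fun setT f ->
  measurable_fun setT g -> measurable [set x | (f x : R) < g x].
Proof.
move=> mf mg; have := measurable_fun_ltr mf mg measurableT (Y := [set true]) Logic.I.
by rewrite setTI; congr measurable; apply/seteqP; split.
Qed.

Lemma measurable_sqrt_fun (f : T -> mR) : measurable_fun setT f ->
  measurable_fun setT (fun x => Num.sqrt (f x : R) : mR).
Proof.
move=> mf; apply: (measurableT_comp (f := @Num.sqrt R : mR -> mR)) => //.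
by apply: continuous_measurable_fun; exact: sqrt_continuous.
Qed.

Lemma measurable_norm_fun (f : T -> mR) : measurable_fun setT f ->
  measurable_fun setT (fun x => `|f x : R| : mR).
Proof.
move=> mf; apply: (measurableT_comp (f := fun x : mR => `|x : R| : mR)) => //.
by apply: continuous_measurable_fun; exact: norm_continuous.
Qed.

Lemma measurable_tnth_fun k (f : T -> Rpoint R k) j : measurable_fun setT f ->
  measurable_fun setT (fun x => tnth (f x) j : mR).
Proof.
move=> mf; apply: (measurableT_comp (f := fun p : Rpoint R k => tnth p j : mR)) => //.
exact: measurable_tnth.
Qed.

Lemma measurable_sqnorm_fun k (f g : T -> Rpoint R k) :
  measurable_fun setT f -> measurable_fun setT g ->
  measurable_fun setT
    (fun x => \sum_(j < k) ((tnth (f x) j : R) - tnth (g x) j) ^+ 2 : mR).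
Proof.
move=> mf mg; apply: measurable_sum => j; apply: measurable_funX.
by apply: measurable_funB; exact: measurable_tnth_fun.
Qed.

Lemma measurable_dist2 k (f g : T -> Rpoint R k) :
  measurable_fun setT f -> measurable_fun setT g ->
  measurable_fun setT (fun x => dist2 (f x) (g x) : mR).
Proof. by move=> mf mg; exact/measurable_sqrt_fun/measurable_sqnorm_fun. Qed.

Lemma measurable_cube_preimage k (f : T -> Rpoint R k) : measurable_fun setT f ->
  measurable [set x | unit_cube (f x)].
Proof.
move=> mf; rewrite -[X in measurable X]setTI.
by apply: mf => //; exact: measurable_unit_cube.
Qed.

End measurable_comparison.

(** * Harmonic sums and integration by layers *)

Section harmonic.
Context {R : realType}.

Definition harmonic_sum (J : nat) : R := \sum_(j < J) (j.+1%:R)^-1.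

Lemma harmonic_sum_ge0 J : 0 <= harmonic_sum J.
Proof. by apply: sumr_ge0 => j _; rewrite invr_ge0. Qed.

Lemma harmonic_sum_le J : (0 < J)%N -> harmonic_sum J <= 1 + ln J%:R.
Proof.
case: J => // J _; elim: J => [|J IH].
  by rewrite /harmonic_sum big_ord_recl big_ord0 invr1 ln1.
rewrite /harmonic_sum big_ord_recr /=; move: IH; rewrite /harmonic_sum => IH.
(* This is ln (1 + u) <= u at u = -1 / (J + 2). *)
have : (J.+2%:R)^-1 <= ln J.+2%:R - ln J.+1%:R :> R.
  have -> : ln J.+2%:R - ln J.+1%:R = - ln (J.+1%:R / J.+2%:R) :> R.
    by rewrite lnM ?posrE ?invr_gt0 ?ltr0n// lnV ?posrE ?ltr0n//; ring.
  have h : 0 < (J.+1%:R / J.+2%:R : R) by rewrite divr_gt0 ?ltr0n.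
  have E : (J.+1%:R / J.+2%:R : R) = 1 + (- (J.+2%:R)^-1).
    have : (J.+2%:R : R) != 0 by rewrite pnatr_eq0.
    rewrite -[J.+2%:R]natr1; move: (J.+1%:R : R) => t t0.
    by apply: (mulIf t0); rewrite mulrBl mulfVK// mulVf// mul1r addrK.
  have lt1 : -1 < - (J.+2%:R)^-1 :> R by rewrite ltrN2 -subr_gt0 -E.
  by rewrite lerNr E; exact: le_ln1Dx.
by move=> h; apply: (le_trans (lerD IH h)); rewrite -addrA lerD2l addrC subrK.
Qed.

(* min(1, K / w) is at most K plus K times the number of j <= J with w <= 1 / j,
   so that its integral becomes a harmonic sum. *)
Lemma le_layer_sum (w K : R) (J : nat) (tau : \bar R) : 0 <= K ->
  1 <= K * J%:R -> (tau <= 1)%E -> (0 < w -> (tau <= (K / w)%:E)%E) ->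
  (tau <= (K + \sum_(j < J) K * (w <= (j.+1%:R)^-1)%R%:R)%:E)%E.
Proof.
move=> K0 KJ tau1 tauw.
(* If no layer lies below w, all J of them count and K J >= 1 suffices. Otherwise let j0 be the
   first one below w: then K / w <= K + K j0, and the j0 earlier layers all count. *)
have [ex|nex] := pselect (exists j, (j < J)%N && ((j.+1%:R)^-1 < w)); last first.
  apply: (le_trans tau1); rewrite lee_fin; apply: (le_trans KJ).
  rewrite (eq_bigr (fun=> K)) => [|j _].
    by rewrite sumr_const card_ord mulr_natr lerDr.
  rewrite (_ : (w <= _) = true) ?mulr1//; apply/negPn/negP; rewrite -ltNge => h.
  by apply: nex; exists j; rewrite ltn_ord.
case: (ex_minnP ex) => j0 /andP[j0J j0w] minj0.
have w0 : 0 < w by apply: lt_trans j0w; rewrite invr_gt0.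
apply: (le_trans (tauw w0)); rewrite lee_fin.
apply: (@le_trans _ _ (K * j0.+1%:R)).
  by rewrite ler_wpM2l// -[leRHS]invrK lef_pV2 ?posrE ?invr_gt0// ltW.
rewrite -natr1 mulrDr mulr1 addrC lerD2l.
rewrite -(big_mkord xpredT (fun j => K * (w <= (j.+1%:R)^-1)%R%:R)).
rewrite (big_cat_nat _ (n := j0)) //=; last exact: ltnW.
rewrite -[leLHS]addr0 lerD//; last by apply: sumr_ge0 => j _; rewrite mulr_ge0.
rewrite big_nat (eq_bigr (fun=> K)) => [|j jj0].
  by rewrite -big_nat sumr_const_nat subn0 mulr_natr.
rewrite (_ : (w <= _) = true) ?mulr1//; apply/negPn/negP; rewrite -ltNge => h.
have := minj0 j; rewrite h andbT; case/andP: jj0 => _ jj0.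
by rewrite (ltn_trans jj0 j0J) leqNgt jj0 => /(_ isT).
Qed.

End harmonic.

(** * Two independent points *)

Section pair_bound.
Context {R : realType} {d : nat}.
Local Notation mR := (measurableTypeR R).
Local Notation point := (Rpoint R (d + 2)).
Local Notation lam := (@lebesgue_tuple R (d + 2)).
Variables (a b : point) (eps : R) (J : nat).
Hypotheses (ca : unit_cube a) (cb : unit_cube b) (gab : 0 < plane_gap a b).
Hypotheses (eps0 : 0 < eps) (Jeps : 1 <= eps * J%:R).

Let F (x : point) : R := dist2 x a - dist2 x b.
Let K : R := 88 * Num.sqrt (d + 2)%:R ^+ 3 * eps / plane_gap a b.

Let mW : measurable_fun setT (weight a b : point -> mR).
Proof.
apply: measurable_funM.
  apply: measurable_sqrt_fun; apply: measurable_funM; last exact: measurable_cst.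
  apply: measurable_norm_fun; apply: measurable_funB; apply: measurable_sqnorm_fun => //;
    exact: measurable_id.
apply: measurable_funM; last exact: measurable_cst.
apply: measurable_norm_fun; apply: measurable_funB; apply: measurable_funM;
  try exact: measurable_cst; apply: measurable_funB; try exact: measurable_cst;
  apply: measurable_tnth_fun; exact: measurable_id.
Qed.

Let gap_le1 : plane_gap a b <= 1.
Proof.
rewrite /plane_gap ge_max; apply/andP; split; rewrite ler_norml; apply/andP; split.
all: rewrite /plane_fst /plane_snd.
- by have /andP[? ?] := ca (rshift d ord0); have /andP[? ?] := cb (rshift d ord0); lra.
- by have /andP[? ?] := ca (rshift d ord0); have /andP[? ?] := cb (rshift d ord0); lra.
- by have /andP[? ?] := ca (rshift d ord_max); have /andP[? ?] := cb (rshift d ord_max); lra.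
- by have /andP[? ?] := ca (rshift d ord_max); have /andP[? ?] := cb (rshift d ord_max); lra.
Qed.

(** The gap is at most 1, so a cutoff [J] chosen from eps alone satisfies 1 <= K J for every
    admissible a and b. *)
Let K_ge : eps <= K.
Proof.
rewrite /K ler_pdivlMr//; apply: (@le_trans _ _ eps); first by rewrite ler_piMr// ltW.
rewrite ler_peMl ?(ltW eps0)//.
have : 1 <= Num.sqrt (d + 2)%:R ^+ 3 :> R.
  by rewrite exprn_ege1// -{1}sqrtr1 ler_wsqrtr// ler1n addn2.
by move=> ?; lra.
Qed.

Let K_ge0 : 0 <= K. Proof. exact: le_trans (ltW eps0) K_ge. Qed.

Let KJ : 1 <= K * J%:R.
Proof. by apply: (le_trans Jeps); rewrite ler_wpM2r. Qed.

Let M : R := K + K * (44 * harmonic_sum J).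

(** Layer j is a sublevel set of the weight at 1 / (j + 1), of measure at most 44 / (j + 1); the
    leading K is the contribution of the whole cube. *)
Lemma integral_min_weight (h : point -> \bar R) :
  (forall c, 0 <= h c)%E -> (forall c, ~ unit_cube c -> h c = 0%E) ->
  (forall c, h c <= 1)%E -> (forall c, 0 < weight a b c -> (h c <= (K / weight a b c)%:E)%E) ->
  (\int[lam]_c h c <= M%:E)%E.
Proof.
move=> h0 hcube h1 hw.
pose Wj (j : nat) := unit_cube `&` [set c | weight a b c <= (j.+1%:R)^-1].
have mWj j : measurable (Wj j).
  apply: measurableI; first exact: measurable_unit_cube.
  by apply: measurable_le_set => //; exact: measurable_cst.
have mcube := @measurable_unit_cube R (d + 2).
have mterm (B : set point) : measurable B ->
    measurable_fun setT (fun c => K%:E * (\1_B c)%:E)%E.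
  move=> mB; apply: measurable_funeM; exact/measurable_EFinP/measurable_indic.
have term0 (B : set point) c : (0 <= K%:E * (\1_B c)%:E)%E by rewrite mule_ge0 ?lee_fin.
have intB (B : set point) : measurable B -> (\int[lam]_c (K%:E * (\1_B c)%:E) = K%:E * lam B)%E.
  move=> mB; rewrite ge0_integralZl//; first by rewrite integral_indic// setIT.
  exact/measurable_EFinP/measurable_indic.
apply: (@le_trans _ _ (\int[lam]_c (K%:E * (\1_unit_cube c)%:E
   + \sum_(j < J) (K%:E * (\1_(Wj j) c)%:E)))%E).
  apply: nonneg_le_integral => // c.
  have [cc|nc] := pselect (unit_cube c); last first.
    by rewrite hcube// adde_ge0// sume_ge0.
  apply: (le_trans (le_layer_sum K_ge0 KJ (h1 c) (hw c))).
  rewrite EFinD -sumEFin indicE mem_set// mule1 leeD2l//.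
  apply: lee_sum => j _; rewrite indicE -EFinM lee_fin ler_wpM2l//.
  have [wj|_] := boolP (weight a b c <= _); last by rewrite ler0n.
  by rewrite mem_set.
rewrite ge0_integralD//; last 3 first.
- exact: mterm.
- by move=> c _; rewrite sume_ge0.
- by apply: emeasurable_sum => j; exact: mterm.
rewrite ge0_integral_sum//; last by move=> j; exact: mterm.
rewrite intB// /M EFinD; apply: leeD.
  by rewrite -[leRHS]mule1 lee_wpmul2l ?lee_fin// lebesgue_unit_cube_le1.
rewrite /harmonic_sum !mulr_sumr -sumEFin; apply: lee_sum => j _.
rewrite intB// [leRHS]EFinM; apply: lee_wpmul2l; first by rewrite lee_fin.
by apply: (weight_sublevel (mWj j) gab); rewrite ?invr_gt0// => c [].
Qed.

Lemma level_section_le (y w : R) (A : set point) : measurable A ->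
  A `<=` unit_cube -> (forall x, A x -> y <= F x <= y + eps /\ w <= weight a b x) ->
  (lam A <= 1)%E /\ (0 < w -> (lam A <= (K / w)%:E)%E).
Proof.
move=> mA Acube Aw; split.
  apply: le_trans (@lebesgue_unit_cube_le1 R d).
  by apply: le_measure; rewrite ?inE//; exact: measurable_unit_cube.
move=> w0; apply: (le_trans (weight_level (y := y) mA gab eps0 w0 ca cb Acube Aw)).
by rewrite lee_fin /K invfM mulrA.
Qed.

(** [E1] is cut at its first point and [E2] at its second, in each case the one of smaller weight.
    The section then lies in a level window of width eps where the weight is bounded below by a
    constant, and its measure satisfies the hypotheses of [integral_min_weight]. *)
Lemma pair_level_le (E : set (point * point)) : measurable E ->
  (forall z, E z -> [/\ unit_cube z.1, unit_cube z.2 & 0 <= F z.1 - F z.2 <= eps]) ->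
  ((lam \x lam) E <= (2 * M)%:E)%E.
Proof.
move=> mE Ecube.
pose E1 := E `&` [set z | weight a b z.1 <= weight a b z.2].
pose E2 := E `&` [set z | weight a b z.2 <= weight a b z.1].
have mW1 : measurable_fun setT ((fun z => weight a b z.1) : point * point -> mR).
  by apply: measurableT_comp.
have mW2 : measurable_fun setT ((fun z => weight a b z.2) : point * point -> mR).
  by apply: measurableT_comp.
have mE1 : measurable E1 by apply: measurableI => //; exact: measurable_le_set.
have mE2 : measurable E2 by apply: measurableI => //; exact: measurable_le_set.
have -> : E = E1 `|` E2.
  rewrite -setIUr; apply/esym/setIidPl => z _; exact/orP/le_total.
apply: (le_trans (measureU2 _ mE1 mE2)).
rewrite (_ : 2 * M = M + M) ?EFinD; last by ring.
have sec1 x : (lam (xsection E1 x) <= 1)%E /\ (0 < weight a b x ->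
    (lam (xsection E1 x) <= (K / weight a b x)%:E)%E).
  apply: (@level_section_le (F x - eps)).
  - exact: measurable_xsection.
  - by move=> c; rewrite /xsection/= inE => -[/Ecube[]].
  - move=> c; rewrite /xsection/= inE => -[/Ecube[_ _ /andP[/= ? ?]] ?].
    by split => //; apply/andP; split; lra.
have sec2 x : (lam (ysection E2 x) <= 1)%E /\ (0 < weight a b x ->
    (lam (ysection E2 x) <= (K / weight a b x)%:E)%E).
  apply: (@level_section_le (F x)).
  - exact: measurable_ysection.
  - by move=> c; rewrite /ysection/= inE => -[/Ecube[]].
  - move=> c; rewrite /ysection/= inE => -[/Ecube[_ _ /andP[/= ? ?]] ?].
    by split => //; apply/andP; split; lra.
apply: leeD.
  apply: integral_min_weight => [x|x nx|x|x wx].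
  - exact: measure_ge0.
  - rewrite /= (_ : xsection _ _ = set0) ?measure0//; apply/seteqP; split => // c.
    by rewrite /xsection/= inE => -[/Ecube[]].
  - exact: (sec1 x).1.
  - exact: (sec1 x).2.
(* Here the second point is held fixed, so the order of integration is exchanged. *)
rewrite [leLHS](_ : _ = (lam \x^ lam)%E E2); last first.
  by apply: product_measure_unique => //= *; rewrite product_measure2E.
apply: integral_min_weight => [x|x nx|x|x wx].
- exact: measure_ge0.
- rewrite /= (_ : ysection _ _ = set0) ?measure0//; apply/seteqP; split => // c.
  by rewrite /ysection/= inE => -[/Ecube[]].
- exact: (sec2 x).1.
- exact: (sec2 x).2.
Qed.

End pair_bound.

(** * Four independent points *)

Section joint_law.
Local Open Scope ereal_scope.
Context {disp : measure_display} {Omega : measurableType disp} {R : realType}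
  (P : probability Omega R).

(** For P(G) > 0 the law of Z on G, divided by P(G), agrees with the product measure on rectangles,
    hence everywhere. The event G carries the variables not yet absorbed into a product, so that
    several can be joined one at a time. *)
Lemma event_joint_law (d1 d2 : measure_display) (T1 : measurableType d1)
    (T2 : measurableType d2) (m1 : {sigma_finite_measure set T1 -> \bar R})
    (m2 : {sigma_finite_measure set T2 -> \bar R}) (G : set Omega)
    (Z : Omega -> T1 * T2) : measurable G -> measurable_fun setT Z ->
  (forall B C, measurable B -> measurable C ->
    P (G `&` Z @^-1` (B `*` C)) = P G * (m1 B * m2 C)) ->
  forall E, measurable E -> P (G `&` Z @^-1` E) = P G * (m1 \x m2) E.
Proof.
move=> mG mZ GZ E mE.
have mZE (D : set (T1 * T2)) : measurable D -> measurable (Z @^-1` D).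
  by move=> mD; rewrite -[X in measurable X]setTI; exact: mZ.
have [PG0|PG0] := eqVneq (P G) 0.
  rewrite PG0 mul0e; apply/eqP; rewrite eq_le measure_ge0 andbT -PG0.
  by apply: le_measure; rewrite ?inE//; apply: measurableI => //; exact: mZE.
have PGfin : P G \is a fin_num by exact: fin_num_measure.
have g0 : (0 < fine (P G))%R by rewrite fine_gt0// lt0e PG0 measure_ge0 -ge0_fin_numE.
have g0' : (0 <= (fine (P G))^-1)%R by rewrite invr_ge0 ltW.
pose nu := measure_function_pushforward__canonical__measure_function_Measure
  (mrestr P mG) mZ.
have nuE D : nu D = P (G `&` Z @^-1` D) by rewrite /nu/= /pushforward /mrestr setIC.
have gK x : P G * ((fine (P G))^-1%:E * x) = x.
  by rewrite muleA -{1}(fineK PGfin) -EFinM mulfV ?mul1e// gt_eqF.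
rewrite (product_measure_unique (m' := mscale (NngNum g0') nu))//.
  by rewrite /= /mscale /= [nu _]nuE gK.
move=> B C mB mC; rewrite /= /mscale/= [nu _]nuE GZ// muleA.
by rewrite -[X in _%:E * X]fineK// -EFinM mulVf ?mul1e// gt_eqF.
Qed.

End joint_law.

(** * Replacing bounded densities by Lebesgue measure *)

Section density.
Context {R : realType} {d : nat} {disp : measure_display}
  {Omega : measurableType disp} (P : probability Omega R).

Lemma distribution_le_lebesgue (phi : R) (f : Rpoint R d -> R)
    (X : {RV P >-> Rpoint R d}) : 0 <= phi ->
  (forall p, unit_cube p -> 0 <= f p <= phi) -> has_density X f ->
  forall A, measurable A -> (distribution P X A <= phi%:E * lebesgue_tuple d A)%E.
Proof.
move=> phi0 fphi Xf A mA; rewrite Xf//.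
have mAc : measurable (A `&` unit_cube) by apply: measurableI => //; exact: measurable_unit_cube.
apply: (@le_trans _ _ (phi%:E * lebesgue_tuple d (A `&` unit_cube))%E); last first.
  by rewrite lee_wpmul2l ?lee_fin// le_measure ?inE.
rewrite integral_mkcond; apply: nonneg_integral_le_mul => //.
- by move=> p; apply: erestrict_ge0 => q [_ /fphi/andP[]]; rewrite lee_fin.
- by move=> p /[dup] Ap [_ /fphi/andP[_ ?]]; rewrite patchE mem_set// lee_fin.
- by move=> p Ap; rewrite patchE memNset.
Qed.

Lemma distribution_outside_cube (f : Rpoint R d -> R)
    (X : {RV P >-> Rpoint R d}) : has_density X f ->
  P (X @^-1` ~` unit_cube) = 0%E.
Proof.
move=> Xf; have := Xf (~` unit_cube) (measurableC (@measurable_unit_cube R d)).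
by rewrite setICl integral_set0.
Qed.

Lemma integral_distribution_le (phi : R) (f : Rpoint R d -> R)
    (X : {RV P >-> Rpoint R d}) (h : Rpoint R d -> \bar R) : 0 <= phi ->
  (forall p, unit_cube p -> 0 <= f p <= phi) -> has_density X f ->
  measurable_fun setT h -> (forall p, 0 <= h p)%E ->
  (\int[distribution P X]_p h p <= phi%:E * \int[lebesgue_tuple d]_p h p)%E.
Proof.
move=> phi0 fphi Xf mh h0.
rewrite -(@ge0_integral_mscale _ _ _ _ setT _ (NngNum phi0))//.
by apply: nonneg_le_measure_integral => // A mA; exact: (distribution_le_lebesgue phi0 fphi Xf).
Qed.

Lemma pair_distribution_le (phi : R) (f g : Rpoint R d -> R)
    (X Y : {RV P >-> Rpoint R d}) : 0 <= phi ->
  (forall p, unit_cube p -> 0 <= f p <= phi) -> has_density X f ->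
  (forall p, unit_cube p -> 0 <= g p <= phi) -> has_density Y g ->
  forall S, measurable S ->
  ((distribution P X \x distribution P Y) S <=
    (phi ^+ 2)%:E * (lebesgue_tuple d \x lebesgue_tuple d) S)%E.
Proof.
move=> phi0 fphi Xf gphi Yg S mS.
have mSx : measurable_fun setT (fun x => lebesgue_tuple d (xsection S x)).
  exact: (measurable_fun_xsection (lebesgue_tuple d) mS).
apply: (@le_trans _ _ (\int[distribution P X]_x (phi%:E * lebesgue_tuple d (xsection S x)))%E).
  apply: nonneg_le_integral => x //=; apply: (distribution_le_lebesgue phi0 gphi Yg).
  exact: measurable_xsection.
rewrite ge0_integralZl ?lee_fin// expr2 EFinM -muleA lee_wpmul2l ?lee_fin//.
exact: (integral_distribution_le phi0 fphi Xf).
Qed.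

End density.

(** * Integrability of the inverse gap *)

Section square_singularity.
Context {R : realType} {d : nat}.
Local Notation mR := (measurableTypeR R).
Local Notation leb := (@lebesgue_measure R).
Local Notation point := (Rpoint R (d + 2)).

(** Restricted to [0, 1] because [inv_sqrt_bound] is at least 1 everywhere and has infinite integral
    over the line. *)
Definition unit_inv_sqrt (u x : R) : \bar R :=
  ((fun x : mR => inv_sqrt_bound (x - u)) \_ `[0, 1]%classic) x.

Lemma unit_inv_sqrt_ge0 u x : (0 <= unit_inv_sqrt u x)%E.
Proof. by apply: erestrict_ge0 => *; exact: inv_sqrt_bound_ge0. Qed.

Lemma measurable_unit_inv_sqrt u :
  measurable_fun setT (unit_inv_sqrt u : mR -> \bar R).
Proof.
apply/(measurable_restrictT _ _).1; first exact: measurable_itv.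
by apply: measurable_funTS; exact: measurable_inv_sqrt_bound.
Qed.

Lemma integral_unit_inv_sqrt u : (\int[leb]_x unit_inv_sqrt u x <= 9%:E)%E.
Proof.
rewrite -integral_mkcond; apply: (le_trans (integral_inv_sqrt_bound _ _)) => //.
by rewrite lee_fin; lra.
Qed.

(** A majorant of the inverse gap: max(|u|, |v|) is at least the geometric mean of |u| and |v|.
    Unlike the inverse gap it is a product over the two coordinates, so its integral is at most 9 *
    9. *)
Definition gap_bound (b a : point) : \bar R :=
  ((\1_(unit_cube : set point) a)%:E *
  (unit_inv_sqrt (plane_fst b) (plane_fst a) * unit_inv_sqrt (plane_snd b) (plane_snd a)))%E.

Lemma gap_bound_ge0 b a : (0 <= gap_bound b a)%E.
Proof. by rewrite !mule_ge0 ?unit_inv_sqrt_ge0// lee_fin. Qed.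

Lemma measurable_gap_bound b : measurable_fun setT (gap_bound b).
Proof.
apply: emeasurable_funM.
  by apply/measurable_EFinP/measurable_indic; exact: measurable_unit_cube.
by apply: emeasurable_funM; apply: (measurableT_comp (measurable_unit_inv_sqrt _));
  exact: measurable_tnth.
Qed.

Lemma integral_gap_bound b : (\int[lebesgue_tuple (d + 2)]_a gap_bound b a <= 81%:E)%E.
Proof.
apply: integral_lebesgue_tuple_slice => //.
- exact: measurable_gap_bound.
- by move=> p; exact: gap_bound_ge0.
- by move=> p np; rewrite /gap_bound indicE memNset// mul0e.
move=> t.
apply: (@le_trans _ _ (\int[leb]_x (9%:E * unit_inv_sqrt (plane_fst b) x))%E).
  apply: nonneg_le_integral => x; first by apply: integral_ge0 => y _; exact: gap_bound_ge0.
  apply: (@le_trans _ _ (\int[leb]_y (unit_inv_sqrt (plane_fst b) x * unit_inv_sqrt (plane_snd b) y))%E).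
    apply: nonneg_le_integral => y; first exact: gap_bound_ge0.
    rewrite /gap_bound /plane_fst /plane_snd !tnth_rshift.
    rewrite -[leRHS]mul1e lee_wpmul2r ?mule_ge0 ?unit_inv_sqrt_ge0// lee_fin indicE.
    by rewrite lern1 leq_b1.
  rewrite ge0_integralZl ?unit_inv_sqrt_ge0//.
  - by rewrite muleC lee_wpmul2r ?unit_inv_sqrt_ge0// integral_unit_inv_sqrt.
  - exact: measurable_unit_inv_sqrt.
  - by move=> y _; exact: unit_inv_sqrt_ge0.
rewrite ge0_integralZl//.
- rewrite (_ : 81 = 9 * 9) ?EFinM; last by rewrite -natrM.
  by rewrite lee_wpmul2l ?lee_fin// integral_unit_inv_sqrt.
- exact: measurable_unit_inv_sqrt.
- by move=> y _; exact: unit_inv_sqrt_ge0.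
Qed.

Lemma gap_bound_degenerate (a b : point) : unit_cube a ->
  plane_fst a - plane_fst b = 0 -> gap_bound b a = +oo%E.
Proof.
move=> ca ab0.
have I01 j : (tnth a j : R) \in `[0, 1]%classic by apply/mem_set; rewrite /= in_itv; exact: ca.
rewrite /gap_bound indicE mem_set// mul1e /unit_inv_sqrt !patchE !I01 ab0.
by rewrite inv_sqrt_bound0 gt0_mulye// (lt_le_trans _ (inv_sqrt_bound_ge1 _)).
Qed.

Lemma plane_gap_inv_le (a b : point) : unit_cube a -> 0 < plane_gap a b ->
  (((plane_gap a b)^-1)%:E <= gap_bound b a)%E.
Proof.
move=> ca gab.
have I01 j : (tnth a j : R) \in `[0, 1]%classic by apply/mem_set; rewrite /= in_itv; exact: ca.
rewrite /gap_bound indicE mem_set// mul1e /unit_inv_sqrt !patchE !I01.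
set u := plane_fst a - plane_fst b; set v := plane_snd a - plane_snd b.
have [u0|u0] := eqVneq u 0.
  by rewrite u0 inv_sqrt_bound0 gt0_mulye ?leey// (lt_le_trans _ (inv_sqrt_bound_ge1 _)).
have [v0|v0] := eqVneq v 0.
  by rewrite v0 inv_sqrt_bound0 gt0_muley ?leey// (lt_le_trans _ (inv_sqrt_bound_ge1 _)).
apply: (@le_trans _ _ (((Num.sqrt `|u|)^-1)%:E * ((Num.sqrt `|v|)^-1)%:E)%E); last first.
  by apply: lee_pmul; rewrite ?inv_sqrt_le_bound// lee_fin invr_ge0 sqrtr_ge0.
rewrite -EFinM lee_fin -invfM lef_pV2 ?posrE//; last by rewrite mulr_gt0// sqrtr_gt0 normr_gt0.
rewrite -sqrtrM// -[leRHS](ger0_norm (ltW gab)) -[leRHS]sqrtr_sqr ler_wsqrtr// expr2.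
by apply: ler_pM => //; rewrite /plane_gap le_max lexx ?orbT.
Qed.

End square_singularity.

Section four_points.
Context {R : realType} {n d : nat} {disp : measure_display}
  {Omega : measurableType disp} (P : probability Omega R).
Local Notation point := (Rpoint R (d + 2)).

Lemma mutually_independent4 (X : 'I_n -> {RV P >-> point}) (i j k l : 'I_n) :
  mutually_independent X -> uniq [:: i; j; k; l] ->
  forall A B C D : set point,
    measurable A -> measurable B -> measurable C -> measurable D ->
  (P (X i @^-1` A `&` (X j @^-1` B `&` (X k @^-1` C `&` X l @^-1` D))) =
   distribution P (X i) A * (distribution P (X j) B *
     (distribution P (X k) C * distribution P (X l) D)))%E.
Proof.
move=> indX; rewrite /= !inE !negb_or -!andbA andbT.
case/and5P => ij ik il jk /andP[jl kl] A B C D mA mB mC mD.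
pose F u := if u == i then A else if u == j then B else if u == k then C else D.
have mF u : measurable (F u) by rewrite /F; repeat case: ifP => _.
have := indX [set i; j; k; l]%SET F mF.
have Fi : F i = A by rewrite /F eqxx.
have Fj : F j = B by rewrite /F eqxx (eq_sym j) (negbTE ij).
have Fk : F k = C by rewrite /F eqxx !(eq_sym k) (negbTE ik) (negbTE jk).
have Fl : F l = D by rewrite /F !(eq_sym l) (negbTE il) (negbTE jl) (negbTE kl).
rewrite (_ : \bigcap_(u in _) _ =
  X i @^-1` A `&` (X j @^-1` B `&` (X k @^-1` C `&` X l @^-1` D))); last first.
  apply/seteqP; split => w.
    move=> H; split; [|split; [|split]].
    - by rewrite -Fi; apply: H; rewrite /= !inE eqxx.
    - by rewrite -Fj; apply: H; rewrite /= !inE eqxx ?orbT.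
    - by rewrite -Fk; apply: H; rewrite /= !inE eqxx ?orbT.
    - by rewrite -Fl; apply: H; rewrite /= !inE eqxx ?orbT.
  move=> [wA [wB [wC wD]]] u /=; rewrite !inE -!orbA.
  by case/or4P => /eqP->; rewrite ?Fi ?Fj ?Fk ?Fl.
move=> ->.
rewrite (big_setD1 i) /=; last by rewrite !inE eqxx.
rewrite (big_setD1 j) /=; last by rewrite !inE eqxx ?orbT eq_sym ij.
rewrite (big_setD1 k) /=; last by rewrite !inE eqxx ?orbT !(eq_sym k) ik jk.
rewrite (big_setD1 l) /=; last by rewrite !inE eqxx ?orbT !(eq_sym l) il jl kl.
rewrite big1 ?mule1 ?Fi ?Fj ?Fk ?Fl//.
by move=> u; rewrite !inE; case: (u == i); case: (u == j); case: (u == k); case: (u == l).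
Qed.

(** The variables are joined from the inside: k with l given events on i and j, then j given an
    event on i, and finally i. *)
Lemma joint_law4 (X : 'I_n -> {RV P >-> point}) (i j k l : 'I_n) :
  mutually_independent X -> uniq [:: i; j; k; l] ->
  forall E : set (point * (point * (point * point))), measurable E ->
  P [set w | E (X i w, (X j w, (X k w, X l w)))] =
  (distribution P (X i) \x (distribution P (X j) \x
    (distribution P (X k) \x distribution P (X l))))%E E.
Proof.
move=> indX uX E mE.
have ind := mutually_independent4 indX uX.
have mX u : measurable_fun setT (X u) by exact: measurable_funP.
have mXA u (A : set point) : measurable A -> measurable (X u @^-1` A).
  by move=> mA; rewrite -[X in measurable X]setTI; exact: mX.
have PXT u : distribution P (X u) setT = 1%E by exact: probability_setT.
have mkl : measurable_fun setT (fun w => (X k w, X l w)) by exact: measurable_fun_pair.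
have mjkl : measurable_fun setT (fun w => (X j w, (X k w, X l w))).
  exact: measurable_fun_pair.
have mijkl : measurable_fun setT (fun w => (X i w, (X j w, (X k w, X l w)))).
  exact: measurable_fun_pair.
have ind2 A B : measurable A -> measurable B ->
    P (X i @^-1` A `&` X j @^-1` B) = (distribution P (X i) A * distribution P (X j) B)%E.
  move=> mA mB; have := ind A B setT setT mA mB measurableT measurableT.
  by rewrite !preimage_setT !setIT !PXT !mule1.
have law2 A B (D : set (point * point)) : measurable A -> measurable B -> measurable D ->
    P ((X i @^-1` A `&` X j @^-1` B) `&` [set w | D (X k w, X l w)]) =
    (distribution P (X i) A * distribution P (X j) B *
      (distribution P (X k) \x distribution P (X l)) D)%E.
  move=> mA mB mD; rewrite -ind2//.
  apply: (event_joint_law (Z := fun w => (X k w, X l w))) => //.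
    by apply: measurableI; exact: mXA.
  by move=> C D' mC mD'; rewrite ind2// -muleA -ind// -setIA.
pose m2 : probability (point * point)%type R :=
  (distribution P (X k) \x distribution P (X l))%E.
pose m3 : probability (point * (point * point))%type R :=
  (distribution P (X j) \x m2)%E.
have law3 A (D : set (point * (point * point))) : measurable A -> measurable D ->
    P (X i @^-1` A `&` [set w | D (X j w, (X k w, X l w))]) =
    (distribution P (X i) A * (distribution P (X j) \x
      (distribution P (X k) \x distribution P (X l))) D)%E.
  move=> mA mD.
  apply: (event_joint_law (m2 := m2) (Z := fun w => (X j w, (X k w, X l w)))) => //.
    exact: mXA.
  by move=> C D' mC mD'; rewrite muleA -law2// -setIA.
have -> : P [set w | E (X i w, (X j w, (X k w, X l w)))] =
    P (setT `&` (fun w => (X i w, (X j w, (X k w, X l w)))) @^-1` E) by rewrite setTI.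
rewrite (event_joint_law (m1 := distribution P (X i)) (m2 := m3))//.
  by rewrite probability_setT mul1e.
by move=> A D mA mD; rewrite setTI probability_setT mul1e -law3.
Qed.

(* Here b, a, x, c are the positions of v1, u2, u1, v2 in the 2-change that
   replaces u1u2, v1v2 by u1v1, u2v2. *)
Definition two_change_gain (b a x c : point) : R :=
  dist2 x a - dist2 x b - (dist2 c a - dist2 c b).

Definition small_gain (eps : R) : set (point * (point * (point * point))) :=
  [set z | [/\ unit_cube z.1, unit_cube z.2.1, unit_cube z.2.2.1, unit_cube z.2.2.2 &
    0 < two_change_gain z.1 z.2.1 z.2.2.1 z.2.2.2 <= eps]].

Lemma measurable_small_gain eps : measurable (small_gain eps).
Proof.
pose T4 := (point * (point * (point * point)))%type.
have m1 : measurable_fun setT (fun z : T4 => z.1) by exact: measurable_fst.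
have m2 : measurable_fun setT (fun z : T4 => z.2.1).
  by apply: measurableT_comp; [exact: measurable_fst|exact: measurable_snd].
have m22 : measurable_fun setT (fun z : T4 => z.2.2).
  by apply: measurableT_comp; [exact: measurable_snd|exact: measurable_snd].
have m3 : measurable_fun setT (fun z : T4 => z.2.2.1).
  by apply: measurableT_comp; [exact: measurable_fst|exact: m22].
have m4 : measurable_fun setT (fun z : T4 => z.2.2.2).
  by apply: measurableT_comp; [exact: measurable_snd|exact: m22].
have mg : measurable_fun setT (fun z : T4 =>
    two_change_gain z.1 z.2.1 z.2.2.1 z.2.2.2 : measurableTypeR R).
  by apply: measurable_funB; apply: measurable_funB; exact: measurable_dist2.
rewrite (_ : small_gain eps =
  [set z | unit_cube z.1] `&` [set z | unit_cube z.2.1] `&`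
  [set z | unit_cube z.2.2.1] `&` [set z | unit_cube z.2.2.2] `&`
  [set z | (0 : measurableTypeR R) < two_change_gain z.1 z.2.1 z.2.2.1 z.2.2.2] `&`
  [set z | two_change_gain z.1 z.2.1 z.2.2.1 z.2.2.2 <= (eps : measurableTypeR R)]).
  repeat apply: measurableI; try exact: measurable_cube_preimage.
    by apply: measurable_lt_set => //; exact: measurable_cst.
  by apply: measurable_le_set => //; exact: measurable_cst.
apply/seteqP; split => z.
  move=> [h1 h2 h3 h4 /andP[h5 h6]].
  exact: (conj (conj (conj (conj (conj h1 h2) h3) h4) h5) h6).
by move=> [[[[[? ?] ?] ?] ?] ?]; split => //; apply/andP; split.
Qed.

(** The innermost pair u1, v2 gives phi^2 and 176 = 2 * 88, the 2 coming from the two orders of the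
    weights. Integrating the inverse gap over u2 gives phi and 81. The outermost v1 gives no
    factor. *)
Lemma small_gain_prob_le (phi : R) (f : 'I_n -> point -> R)
    (X : 'I_n -> {RV P >-> point}) (i j k l : 'I_n) (eps : R) (J : nat) :
  1 <= phi -> perturbed_instance phi f X -> uniq [:: i; j; k; l] ->
  0 < eps -> 1 <= eps * J%:R ->
  (P [set w | small_gain eps (X i w, (X j w, (X k w, X l w)))] <=
   (81 * 176 * Num.sqrt (d + 2)%:R ^+ 3 * phi ^+ 3 * (eps * (1 + 44 * harmonic_sum J)))%:E)%E.
Proof.
move=> phi1 [_ fphi fX indX] uX eps0 Jeps.
have phi0 : 0 <= phi by exact: le_trans phi1.
have mE := measurable_small_gain eps.
rewrite (joint_law4 indX uX)//.
set C := 176 * Num.sqrt (d + 2)%:R ^+ 3 * phi ^+ 2 * (eps * (1 + 44 * harmonic_sum J)).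
have C_gt0 : 0 < C.
  have phi_gt0 : 0 < phi by exact: lt_le_trans phi1.
  rewrite /C !mulr_gt0 ?exprn_gt0 ?sqrtr_gt0 ?ltr0n ?addn2//.
  by rewrite ltr_wpDr// mulr_ge0// harmonic_sum_ge0.
have C0 := ltW C_gt0.
rewrite [X in (_ <= X%:E)%E](_ : _ = phi * (C * 81)); last by rewrite /C; ring.
apply: integral_probability_le => [|b|b].
- by rewrite lee_fin mulr_ge0// mulr_ge0.
- by apply: integral_ge0 => a _; apply: integral_ge0 => x _; exact: measure_ge0.
set Eb := xsection (small_gain eps) b.
have mEb : measurable Eb by exact: measurable_xsection.
apply: (@le_trans _ _ (\int[distribution P (X j)]_a (C%:E * gap_bound b a))%E).
  apply: nonneg_le_integral => a /=.
    by apply: integral_ge0 => x _; exact: measure_ge0.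
  have mS : measurable (xsection Eb a) by exact: measurable_xsection.
  apply: (le_trans (pair_distribution_le phi0 (fphi k) (fX k) (fphi l) (fX l) mS)).
  have SE z : xsection Eb a z -> small_gain eps (b, (a, z)).
    by rewrite /Eb /xsection/= !inE /= inE.
  have [[ca cb]|ncab] := pselect (unit_cube a /\ unit_cube b); last first.
    rewrite (_ : xsection Eb a = set0) ?measure0 ?mule0; last first.
      by apply/seteqP; split => // z /SE[/= ? ? _ _ _]; apply: ncab.
    by rewrite mule_ge0 ?lee_fin ?gap_bound_ge0.
  (* When the gap is 0 the majorant is infinite and C > 0, so the bound is trivial. *)
  have [gab|gab] := ltP 0 (plane_gap a b); last first.
    have : `|plane_fst a - plane_fst b| <= 0.
      by apply: le_trans gab; rewrite /plane_gap le_max lexx.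
    rewrite normr_le0 => /eqP ab0.
    by rewrite (gap_bound_degenerate ca ab0) gt0_muley ?lte_fin// leey.
  apply: (@le_trans _ _ (C%:E * ((plane_gap a b)^-1)%:E)%E); last first.
    by apply: lee_wpmul2l; rewrite ?lee_fin//; exact: plane_gap_inv_le.
  have Sgain z : xsection Eb a z -> [/\ unit_cube z.1, unit_cube z.2 &
      0 <= (dist2 z.1 a - dist2 z.1 b) - (dist2 z.2 a - dist2 z.2 b) <= eps].
    by move=> /SE[/= _ _ ? ? /andP[/ltW ? ?]]; split => //; apply/andP; split.
  have := pair_level_le ca cb gab eps0 Jeps mS Sgain.
  move=> /(lee_wpmul2l (_ : (0 <= (phi ^+ 2)%:E)%E)) H.
  apply: (le_trans (H _)); first by rewrite lee_fin exprn_ge0.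
  by rewrite -!EFinM lee_fin le_eqVlt; apply/orP; left; apply/eqP; rewrite /C; ring.
rewrite ge0_integralZl//; last 2 first.
  exact: measurable_gap_bound.
  by move=> a _; exact: gap_bound_ge0.
rewrite mulrCA [leRHS]EFinM; apply: lee_wpmul2l; first by rewrite lee_fin.
apply: (le_trans (integral_distribution_le phi0 (fphi j) (fX j) _ _)).
- exact: measurable_gap_bound.
- by move=> a; exact: gap_bound_ge0.
- rewrite [leRHS]EFinM; apply: lee_wpmul2l; first by rewrite lee_fin.
  exact: integral_gap_bound.
Qed.

End four_points.

(** * Tours *)

Section tours.
Context {R : realType} {n d : nat}.
Variable x : 'I_n -> Rpoint R d.

Lemma dist2C (p q : Rpoint R d) : dist2 p q = dist2 q p.
Proof.
by congr Num.sqrt; apply: eq_bigr => j _; rewrite -sqrrN opprB.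
Qed.

Lemma dist2xx (p : Rpoint R d) : dist2 p p = 0.
Proof.
by rewrite /dist2 big1 ?sqrtr0// => j _; rewrite subrr expr0n.
Qed.

(** The symmetric double sum makes the length a function of the unordered edge: each distance occurs
    twice and the diagonal vanishes. *)
Definition edge_length (e : {set 'I_n}) : R :=
  (\sum_(u in e) \sum_(v in e) dist2 (x u) (x v)) / 2.

Lemma edge_lengthE u v : edge_length [set u; v]%SET = dist2 (x u) (x v).
Proof.
rewrite /edge_length; have [->|uv] := eqVneq u v.
  by rewrite finset.setUid !big_set1 dist2xx mul0r.
have sum2 (F : 'I_n -> R) : \sum_(w in [set u; v]%SET) F w = F u + F v.
  by rewrite big_setU1 ?inE//= big_set1.
rewrite !sum2.
by rewrite !dist2xx add0r addr0 (dist2C (x v)); field.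
Qed.

Lemma mem_tour (t : @tour n) u : u \in tour_tuple t.
Proof.
have := uniq_min_size (tour_uniq t) (s2 := enum 'I_n).
rewrite -cardE card_ord [X in (_ <= X)%N]size_tuple leqnn.
by move=> /(_ _ isT)[v|_ ->]; rewrite mem_enum.
Qed.

Lemma next_inj (t : @tour n) : injective (next t).
Proof. exact: (can_inj (prev_next (tour_uniq t))). Qed.

Lemma next_order (t : @tour n) u : fingraph.order (next t) u = n.
Proof.
have := order_cycle (cycle_next (tour_uniq t)) (tour_uniq t) (mem_tour t u).
by rewrite size_tuple.
Qed.

Lemma next_next_neq (t : @tour n) u : (2 < n)%N -> next t (next t u) != u.
Proof.
move=> n2; have := orbit_uniq (next t) u; rewrite /orbit next_order.
case: n n2 t u => [|[|[|m]]]// _ t u /=.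
by rewrite !inE !negb_or => /andP[/and3P[_ /negP H _] _]; apply/negP => /eqP E; apply: H; rewrite E.
Qed.

(** Two vertices could share an edge only by being each other's successor, as in the tour with n =
    2. Injectivity turns the sum over vertices into a sum over the edge set. *)
Lemma edge_inj (t : @tour n) : (2 < n)%N ->
  injective (fun u => [set u; next t u]%SET).
Proof.
move=> n2 u v uv.
have : u \in [set v; next t v]%SET by rewrite -uv !inE eqxx.
have : v \in [set u; next t u]%SET by rewrite uv !inE eqxx.
rewrite !inE => /orP[/eqP//|/eqP vu] /orP[/eqP//|/eqP uv'].
by have := next_next_neq t u n2; rewrite -vu -uv' eqxx.
Qed.

Lemma tour_lengthE (t : @tour n) : (2 < n)%N ->
  tour_length x t = \sum_(e in tour_edges t) edge_length e.
Proof.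
move=> n2; rewrite /tour_edges big_imset/=; last by move=> u v _ _; exact: edge_inj.
by apply: eq_big => // u _; rewrite edge_lengthE.
Qed.

(** The removed edges lie in the tour and the added ones do not, so the remaining edges cancel in
    the difference of lengths. *)
Lemma two_change_gainE (t t' : @tour n) : two_change t t' ->
  exists u1 u2 v1 v2, uniq [:: v1; u2; u1; v2] /\
  tour_length x t - tour_length x t' =
    dist2 (x u1) (x u2) - dist2 (x u1) (x v1)
    - (dist2 (x v2) (x u2) - dist2 (x v2) (x v1)).
Proof.
case/existsP => u1 /existsP[u2 /existsP[v1 /existsP[v2]]].
case/and4P => uq /eqP nu /eqP nv /eqP E'.
have n2 : (2 < n)%N.
  by rewrite -(card_ord n); apply: leq_trans (max_card (mem [:: u1; u2; v1; v2])); rewrite (card_uniqP uq).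
exists u1, u2, v1, v2; move: (uq); rewrite /= !inE !negb_or -!andbA andbT.
case/and5P => u12 u1v1 u1v2 u2v1 /andP[u2v2 v12].
split.
  by rewrite (eq_sym v1 u2) u2v1 (eq_sym v1 u1) u1v1 v12 (eq_sym u2 u1) u12 u2v2 u1v2.
set S := [set [set u1; u2]; [set v1; v2]]%SET.
set S' := [set [set u1; v1]; [set u2; v2]]%SET.
have eSt : S \subset tour_edges t.
  apply/fintype.subsetP => e; rewrite !inE => /orP[]/eqP->; apply/imsetP.
    by exists u1 => //; rewrite nu.
  by exists v1 => //; rewrite nv.
(* For {u1, v1} both successors are known; for {u2, v2} the condition follows from injectivity of
   [next], as u2 and v2 are themselves successors. *)
have notin u v : next t u != v -> next t v != u -> [set u; v]%SET \notin tour_edges t.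
  move=> nuv nvu; apply/imsetP => -[z _ E].
  have zuv : z \in [set u; v]%SET by rewrite E !inE eqxx.
  have nzuv : next t z \in [set u; v]%SET by rewrite E !inE eqxx orbT.
  have u_in : u \in [set z; next t z]%SET by rewrite -E !inE eqxx.
  have v_in : v \in [set z; next t z]%SET by rewrite -E !inE eqxx orbT.
  move: zuv u_in v_in; rewrite !inE => /orP[/eqP zu|/eqP zv].
    move=> _ /orP[/eqP vz|/eqP vz]; last by rewrite vz zu eqxx in nuv.
    move: nzuv; rewrite zu !inE => /orP[/eqP nzu|/eqP nzv]; last by rewrite nzv eqxx in nuv.
    by rewrite vz zu nzu eqxx in nvu.
  move=> /orP[/eqP uz|/eqP uz] _; last by rewrite uz zv eqxx in nvu.
  move: nzuv; rewrite zv !inE => /orP[/eqP nzu|/eqP nzv]; first by rewrite nzu eqxx in nvu.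
  by rewrite uz zv nzv eqxx in nuv.
have S't e : e \in S' -> e \notin tour_edges t.
  rewrite !inE => /orP[]/eqP->.
    by apply: notin; rewrite ?nu ?nv // eq_sym.
  apply: notin; last first.
    by rewrite -nu; apply: contra_neq u1v2 => /next_inj.
  by rewrite -nv; apply: contra_neq u2v1 => /next_inj.
rewrite !tour_lengthE// E' -/S -/S'.
rewrite (big_setID S)/= [X in _ - X](big_setID S')/=.
rewrite (finset.setIidPr eSt).
have -> : (tour_edges t :\: S :|: S') :&: S' = S' by apply/finset.setIidPr; exact: finset.subsetUr.
have -> : (tour_edges t :\: S :|: S') :\: S' = tour_edges t :\: S.
  apply/setP => e; rewrite !finset.in_setD finset.in_setU finset.in_setD.
  have [eS'|_] := boolP (e \in S'); last by rewrite orbF.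
  by rewrite (negbTE (S't _ eS')) andbF.
have S12 : [set u1; u2]%SET \notin [set [set v1; v2]]%SET.
  rewrite inE; apply/eqP => /setP/(_ u1); rewrite !inE eqxx (negbTE u1v1) (negbTE u1v2).
  by [].
have S'12 : [set u1; v1]%SET \notin [set [set u2; v2]]%SET.
  by rewrite inE; apply/eqP => /setP/(_ u1); rewrite !inE eqxx (negbTE u12) (negbTE u1v2).
rewrite /S /S' !big_setU1//= !big_set1 !edge_lengthE (dist2C (x v2) (x u2)) (dist2C (x v2) (x v1)).
by ring.
Qed.

Definition gain (u1 u2 v1 v2 : 'I_n) : R :=
  dist2 (x u1) (x u2) - dist2 (x u1) (x v1) - (dist2 (x v2) (x u2) - dist2 (x v2) (x v1)).

Lemma path_improvement_lt (delta : R) (t : @tour n) (r : seq tour) :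
  (forall s s', improving x s s' -> delta < tour_length x s - tour_length x s') ->
  path (improving x) t r -> (0 < size r)%N ->
  delta * (size r)%:R < tour_length x t - tour_length x (last t r).
Proof.
move=> hd; elim: r t => // s [|s' r] IH t.
  by rewrite /= andbT mulr1 => /hd.
move=> /= /andP[/hd ts psr] _; have := IH s psr isT.
by rewrite /= -[X in _ -> delta * X < _]natr1 mulrDr mulr1 => ?; lra.
Qed.

(** Strictly decreasing lengths make the visited tuples distinct. Counting all tuples is enough,
    since only ln (n^n) = n ln n enters later. *)
Lemma path_improving_size (t : @tour n) (r : seq tour) :
  path (improving x) t r -> (size r <= n ^ n)%N.
Proof.
move=> ptr; pose len (s : n.-tuple 'I_n) : R := \sum_(u < n) dist2 (x u) (x (next s u)).
have : sorted (fun a b : R => b < a) (map len (map (@tour_tuple n) r)).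
  apply: (@path_sorted _ _ (tour_length x t)); rewrite -map_comp path_map.
  by apply: sub_path ptr => s s' /andP[].
move=> /sorted_uniq - /(_ _ _)/map_uniq => H.
have ur : uniq (map (@tour_tuple n) r).
  apply: H; first by move=> a b c ba cb; exact: lt_trans ba.
  by move=> a; exact: ltxx.
rewrite -(size_map (@tour_tuple n)) -(card_uniqP ur).
by apply: leq_trans (max_card _) _; rewrite card_tuple card_ord.
Qed.

Lemma tour_length_ge0 (t : @tour n) : 0 <= tour_length x t.
Proof. by apply: sumr_ge0 => u _; exact: sqrtr_ge0. Qed.

Lemma dist2_cube_le (p q : Rpoint R d) : unit_cube p -> unit_cube q ->
  dist2 p q <= Num.sqrt d%:R.
Proof.
move=> hp hq; apply: ler_wsqrtr.
rewrite [leRHS](_ : _ = \sum_(j < d) 1); last by rewrite sumr_const card_ord.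
apply: ler_sum => j _.
by have /andP[? ?] := hp j; have /andP[? ?] := hq j; nra.
Qed.

Lemma tour_length_le (t : @tour n) : (forall i, unit_cube (x i)) ->
  tour_length x t <= n%:R * Num.sqrt d%:R.
Proof.
move=> cx; rewrite [leRHS](_ : _ = \sum_(u < n) Num.sqrt d%:R); last first.
  by rewrite sumr_const card_ord mulr_natl.
by apply: ler_sum => u _; exact: dist2_cube_le.
Qed.

Definition has_small_gain (eps : R) (q : 'I_n * 'I_n * 'I_n * 'I_n) : bool :=
  let: (v1, u2, u1, v2) := q in
  uniq [:: v1; u2; u1; v2] && (0 < gain u1 u2 v1 v2 <= eps).

(** A deterministic tail sum: each k < size r contributes at least 1. Otherwise every step would
    gain more than L / (k + 1), and the at least k + 1 steps together more than L. *)
Lemma two_opt_size_le (t : @tour n) (r : seq tour) :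
  (forall i, unit_cube (x i)) -> path (improving x) t r ->
  (size r <= \sum_(k < n ^ n) \sum_(q : 'I_n * 'I_n * 'I_n * 'I_n)
     has_small_gain (n%:R * Num.sqrt d%:R / k.+1%:R) q)%N.
Proof.
move=> cx ptr; have := path_improving_size ptr.
set N := (n ^ n)%N => rN.
rewrite -[leqLHS]mul1n -[leqLHS]addn0.
rewrite -(big_mkord xpredT (fun k => \sum_(q : 'I_n * 'I_n * 'I_n * 'I_n)
     has_small_gain (n%:R * Num.sqrt d%:R / k.+1%:R) q))%N.
rewrite (big_cat_nat _ (n := size r))//=; apply: leq_add => //.
rewrite mul1n -[leqLHS](subn0) -[leqLHS]muln1 -sum_nat_const_nat.
rewrite big_nat [leqRHS]big_nat; apply: leq_sum => k /andP[_ kr].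
have r0 : (0 < size r)%N by exact: leq_ltn_trans kr.
have [/existsP[q hq]|] := boolP [exists q : 'I_n * 'I_n * 'I_n * 'I_n,
    has_small_gain (n%:R * Num.sqrt d%:R / k.+1%:R) q].
  by rewrite (bigD1 q)//= hq.
rewrite negb_exists => /forallP nq; exfalso.
have := @path_improvement_lt (n%:R * Num.sqrt d%:R / k.+1%:R) t r _ ptr r0.
have step s s' : improving x s s' ->
    n%:R * Num.sqrt d%:R / k.+1%:R < tour_length x s - tour_length x s'.
  move=> /andP[/two_change_gainE[u1 [u2 [v1 [v2 [uq E]]]]] lt].
  have := nq (v1, u2, u1, v2); rewrite /has_small_gain uq /= /gain -E negb_and.
  by rewrite subr_gt0 lt /= -ltNge.
move=> /(_ step); apply/negP; rewrite -leNgt.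
apply: (@le_trans _ _ (n%:R * Num.sqrt d%:R)).
  by have := tour_length_le t cx; have := tour_length_ge0 (last t r); lra.
rewrite mulrAC ler_pdivlMr// ler_wpM2l ?mulr_ge0 ?sqrtr_ge0//.
by rewrite ler_nat.
Qed.

End tours.

(** * The expected number of steps *)

Section expectation.
Context {R : realType} {n d : nat} {disp : measure_display}
  {Omega : measurableType disp} (P : probability Omega R).
Local Notation point := (Rpoint R (d + 2)).
Local Notation quad := ('I_n * 'I_n * 'I_n * 'I_n)%type.
Variables (phi : R) (f : 'I_n -> point -> R) (X : 'I_n -> {RV P >-> point}).
Hypotheses (phi1 : 1 <= phi) (pX : perturbed_instance phi f X).

Let L : R := n%:R * Num.sqrt (d + 2)%:R.
Let N := (n ^ n)%N.

Let event (k : nat) (q : quad) : set Omega :=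
  let: (v1, u2, u1, v2) := q in
  if uniq [:: v1; u2; u1; v2] then
    [set w | small_gain (L / k.+1%:R) (X v1 w, (X u2 w, (X u1 w, X v2 w)))]
  else set0.

Let outside (i : 'I_n) : set Omega := X i @^-1` ~` unit_cube.

Let mevent k q : measurable (event k q).
Proof.
rewrite /event; move: q => [[[v1 u2] u1] v2]; case: ifP => // _.
rewrite -[X in measurable X]setTI.
have mX u : measurable_fun setT (X u) by exact: measurable_funP.
have : measurable_fun setT (fun w => (X v1 w, (X u2 w, (X u1 w, X v2 w)))).
  by repeat apply: measurable_fun_pair.
by apply => //; exact: measurable_small_gain.
Qed.

Let moutside i : measurable (outside i).
Proof.
rewrite -[X in measurable X]setTI; apply: measurable_funP => //.
by apply: measurableC; exact: measurable_unit_cube.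
Qed.

(** The second sum covers outcomes with a vertex outside the cube, where only the bound N by
    counting holds; these outcomes have probability 0. *)
Lemma two_opt_steps_le w :
  (two_opt_steps (fun i => X i w) <=
   \sum_(k < N) \sum_(q : quad) (\1_(event k q) w)%:E +
   \sum_(i < n) (N%:R%:E * (\1_(outside i) w)%:E))%E.
Proof.
apply: ge_ereal_sup => _ [t [r [[ptr _] ->]]].
have sum0 : (0 <= \sum_(k < N) \sum_(q : quad) (\1_(event k q) w)%:E :> \bar R)%E.
  by apply: sume_ge0 => k _; apply: sume_ge0 => q _; rewrite lee_fin.
have sum0' : (0 <= \sum_(i < n) (N%:R%:E * (\1_(outside i) w)%:E) :> \bar R)%E.
  by apply: sume_ge0 => k _; rewrite mule_ge0 ?lee_fin.
have [cube|/existsNP[i ni]] := pselect (forall i, unit_cube (X i w)).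
  apply: (@le_trans _ _ (\sum_(k < N) \sum_(q : quad) (\1_(event k q) w)%:E)%E); last by rewrite leeDl.
  have := two_opt_size_le cube ptr; rewrite -(ler_nat R) -lee_fin => /le_trans; apply.
  rewrite natr_sum -sumEFin; apply: lee_sum => k _.
  rewrite natr_sum -sumEFin; apply: lee_sum => q _; rewrite lee_fin indicE ler_nat.
  have [hq|] := boolP (has_small_gain _ _ q); last by [].
  rewrite mem_set//; move: q hq => [[[v1 u2] u1] v2] /andP[uq gq].
  by rewrite /event uq; split; try exact: cube.
apply: (@le_trans _ _ (\sum_(i < n) (N%:R%:E * (\1_(outside i) w)%:E))%E); last by rewrite leeDr.
apply: (@le_trans _ _ N%:R%:E); first by rewrite lee_fin ler_nat (path_improving_size ptr).
rewrite (bigD1 i)//= indicE mem_set// mule1 leeDl// sume_ge0//.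
Qed.

Lemma expected_two_opt_steps_le :
  (\int[P]_w two_opt_steps (fun i => X i w) <=
   \sum_(k < N) \sum_(q : quad) P (event k q))%E.
Proof.
have mind (A : set Omega) : measurable A -> measurable_fun setT (fun w => (\1_A w)%:E : \bar R).
  by move=> mA; exact/measurable_EFinP/measurable_indic.
have ind0 (A : set Omega) w : (0 <= (\1_A w)%:E :> \bar R)%E by rewrite lee_fin.
(* No sign is assumed of the supremum: its integral is at most that of its positive part, to which
   monotonicity for nonnegative integrands applies. *)
rewrite integralE.
apply: (@le_trans _ _ (\int[P]_w (fun w => two_opt_steps (fun i => X i w))^\+ w)%E).
  rewrite -[leRHS]sube0 leeD2l// leeN2.
  by apply: integral_ge0.
apply: (@le_trans _ _ (\int[P]_w (\sum_(k < N) \sum_(q : quad) (\1_(event k q) w)%:E +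
   \sum_(i < n) (N%:R%:E * (\1_(outside i) w)%:E)))%E).
  apply: nonneg_le_integral => // w; rewrite funeposE ge_max two_opt_steps_le/=.
  by apply: adde_ge0; apply: sume_ge0 => k _; [apply: sume_ge0|rewrite mule_ge0 ?lee_fin].
have mZ (A : set Omega) : measurable A -> measurable_fun setT (fun w => (N%:R%:E * (\1_A w)%:E)%E : \bar R).
  by move=> mA; apply: measurable_funeM; exact: mind.
rewrite ge0_integralD//; last 4 first.
- by move=> w _; apply: sume_ge0 => k _; apply: sume_ge0.
- by apply: emeasurable_sum => k; apply: emeasurable_sum => q; exact: mind.
- by move=> w _; apply: sume_ge0 => i _; rewrite mule_ge0 ?lee_fin.
- by apply: emeasurable_sum => i; exact: mZ.
rewrite [X in (_ + X)%E](_ : _ = 0%E) ?adde0.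
  rewrite ge0_integral_sum//; last 2 first.
  - by move=> k; apply: emeasurable_sum => q; exact: mind.
  - by move=> k w _; apply: sume_ge0.
  apply: lee_sum => k _; rewrite ge0_integral_sum//; last by move=> q; exact: mind.
  by apply: lee_sum => q _; rewrite integral_indic// setIT.
rewrite ge0_integral_sum//; last by move=> i; exact: mZ.
rewrite big1// => i _; rewrite ge0_integralZl//; last exact: mind.
have [_ _ fX _] := pX.
have -> : (\int[P]_w (\1_(outside i) w)%:E = 0)%E; last by rewrite mule0.
by rewrite integral_indic// setIT; exact: (distribution_outside_cube (fX i)).
Qed.

Let H : R := harmonic_sum N.
Let C : R := 81 * 176 * Num.sqrt (d + 2)%:R ^+ 3.

Let sqrt_ge1 : 1 <= Num.sqrt (d + 2)%:R :> R.
Proof. by rewrite -{1}sqrtr1 ler_wsqrtr// ler1n addn2. Qed.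

(** As L >= 1 and k + 1 <= N, the cutoff N is admissible for every threshold L / (k + 1). *)
Let event_prob k q : (0 < n)%N -> (k < N)%N ->
  (P (event k q) <= (C * phi ^+ 3 * (L / k.+1%:R * (1 + 44 * H)))%:E)%E.
Proof.
move=> n0 kN; have L1 : 1 <= L.
  by rewrite /L -[leLHS]mulr1 ler_pM// ler1n.
have L0 : 0 < L by exact: lt_le_trans L1.
have eps0 : 0 < L / k.+1%:R by rewrite divr_gt0.
move: q => [[[v1 u2] u1] v2]; rewrite /event; case: ifPn => uq; last first.
  have phi0 : 0 <= phi by exact: le_trans phi1.
  rewrite measure0 lee_fin mulr_ge0 ?mulr_ge0 ?exprn_ge0 ?sqrtr_ge0 ?(ltW eps0)//.
  by rewrite addr_ge0// mulr_ge0// harmonic_sum_ge0.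
apply: (small_gain_prob_le phi1 pX uq eps0).
rewrite mulrAC ler_pdivlMr// mul1r -[leLHS]mul1r ler_pM// ler_nat.
exact: kN.
Qed.

Lemma expected_two_opt_steps_harmonic_le : (0 < n)%N ->
  (\int[P]_w two_opt_steps (fun i => X i w) <=
   (C * phi ^+ 3 * n%:R ^+ 4 * L * H * (1 + 44 * H))%:E)%E.
Proof.
move=> n0; apply: (le_trans expected_two_opt_steps_le).
apply: (@le_trans _ _ (\sum_(k < N) (n%:R ^+ 4 * (C * phi ^+ 3 * (L / k.+1%:R * (1 + 44 * H))))%:E)%E).
  apply: lee_sum => k _.
  apply: (@le_trans _ _ (\sum_(q : quad) (C * phi ^+ 3 * (L / k.+1%:R * (1 + 44 * H)))%:E)%E).
    by apply: lee_sum => q _; exact: event_prob.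
  rewrite sumEFin sumr_const lee_fin !card_prod card_ord -[leLHS]mulr_natl.
  by rewrite -natrX (_ : (n * n * n * n)%N = (n ^ 4)%N)//; rewrite !expnS expn0 muln1 !mulnA.
rewrite sumEFin lee_fin le_eqVlt; apply/orP; left; apply/eqP.
rewrite [RHS](_ : _ = n%:R ^+ 4 * (C * phi ^+ 3) * L * (1 + 44 * H) * H); last by ring.
move: (1 + 44 * H) => h; rewrite /H /harmonic_sum mulr_sumr.
by apply: eq_bigr => k _; ring.
Qed.

(** There are no four distinct vertices. This covers n = 1, where the target bound is 0 because ln 1
    = 0. *)
Lemma expected_two_opt_steps_small_le : (n < 4)%N ->
  (\int[P]_w two_opt_steps (fun i => X i w) <= 0)%E.
Proof.
move=> n4; apply: (le_trans expected_two_opt_steps_le).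
rewrite big1// => k _; rewrite big1// => -[[[v1 u2] u1] v2] _.
rewrite /event; case: ifPn => [/card_uniqP uq|]; last by rewrite measure0.
have := max_card (mem [:: v1; u2; u1; v2]).
by rewrite uq card_ord leqNgt n4.
Qed.

End expectation.

Theorem theorem6 (R : realType) (d : nat) (hd : (2 <= d)%N) :
  exists C : R, forall (n : nat) (phi : R), (0 < n)%N -> 1 <= phi ->
    forall (disp : measure_display) (Omega : measurableType disp)
      (P : probability Omega R)
      (f : 'I_n -> Rpoint R d -> R) (X : 'I_n -> {RV P >-> Rpoint R d}),
    perturbed_instance phi f X ->
    (\int[P]_w two_opt_steps (fun i => X i w)
       <= (C * n%:R ^+ 7 * ln n%:R ^+ 2 * phi ^+ 3)%:E)%E.
Proof.
rewrite -(subnK hd); move: (d - 2)%N => {hd}d.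
pose C0 : R := 81 * 176 * Num.sqrt (d + 2)%:R ^+ 3.
exists (180 * C0 * Num.sqrt (d + 2)%:R) => n phi n0 phi1 disp Omega P f X pX.
have phi0 : 0 <= phi by exact: le_trans phi1.
have C00 : 0 <= C0 by rewrite !mulr_ge0 ?exprn_ge0 ?sqrtr_ge0.
have [n4|n4] := ltnP n 4.
  apply: (le_trans (expected_two_opt_steps_small_le pX n4)); rewrite lee_fin.
  by rewrite !mulr_ge0 ?exprn_ge0 ?sqrtr_ge0 ?ln_ge0 ?ler1n.
apply: (le_trans (expected_two_opt_steps_harmonic_le phi1 pX n0)).
rewrite lee_fin -/C0; set H := harmonic_sum _; set S := Num.sqrt _.
have nR : 4 <= n%:R :> R by rewrite (ler_nat _ 4).
set l := n%:R * ln n%:R : R.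
(* From ln n >= 1 - 1 / n follows l >= n - 1. *)
have l1 : 1 <= l.
  have : 1 - n%:R^-1 <= ln n%:R :> R.
    have ninv : 0 < n%:R^-1 :> R by rewrite invr_gt0; lra.
    rewrite -[X in _ <= ln X]invrK lnV ?posrE// lerNr.
    have -> : n%:R^-1 = 1 + (n%:R^-1 - 1) :> R by ring.
    have lt1 : -1 < n%:R^-1 - 1 :> R by lra.
    by apply: (le_trans (le_ln1Dx lt1)); lra.
  move=> /(ler_wpM2l (ler0n R n)) h; apply: le_trans h.
  by rewrite mulrBr mulr1 divff ?lt0r_neq0//; lra.
have HN : H <= 1 + l.
  have -> : l = ln (n ^ n)%:R by rewrite /l natrX lnXn ?ltr0n// mulr_natl.
  by apply: harmonic_sum_le; rewrite expn_gt0 n0.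
have H0 : 0 <= H by exact: harmonic_sum_ge0.
(* With H <= 1 + l <= 2 l the left side is at most 2 l * 89 l = 178 l^2. *)
have HH : H * (1 + 44 * H) <= 180 * l ^+ 2 by nra.
have -> : C0 * phi ^+ 3 * n%:R ^+ 4 * (n%:R * S) * H * (1 + 44 * H) =
  C0 * phi ^+ 3 * n%:R ^+ 5 * S * (H * (1 + 44 * H)) by ring.
have -> : 180 * C0 * S * n%:R ^+ 7 * ln n%:R ^+ 2 * phi ^+ 3 =
  C0 * phi ^+ 3 * n%:R ^+ 5 * S * (180 * l ^+ 2) by rewrite /l; ring.
by rewrite ler_wpM2l// !mulr_ge0 ?exprn_ge0 ?sqrtr_ge0.
Qed.
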